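(* For each $\epsilon>0$ there exists $\delta=\delta(\epsilon)>0$ such that whenever $\beta>0$ and $\Delta\in(0,1)$ satisfy $(\beta J)\Delta^3\le\delta$, then $$\liminf_{L\to\infty}\widetilde F^{(\Delta,\alpha)}_{L,\beta}(\theta^\star)\ge\widetilde F_\alpha(\theta^\star)-\epsilon$$ for all $\theta^\star\in[0,2\pi)$ and all $\alpha\in\{1,2,3\}$ (limit along even $L$).
   Context: On $\mathbb T_L=\mathbb Z^3/(L\mathbb Z)^3$, $L$ even, let $\mathscr H_L(\boldsymbol\theta)=\frac J2\sum_{\boldsymbol r}\sum_{\gamma=1}^3(\cos(\theta_{\boldsymbol r}-\phi_\gamma)-\cos(\theta_{\boldsymbol r+\hat{\mathrm e}_\gamma}-\phi_\gamma))^2$, $\phi_1=0,\phi_2=\tfrac{2\pi}3,\phi_3=-\tfrac{2\pi}3$, $J>0$ (the 120$^\circ$-model in angle variables). For $\alpha\in\{1,2,3\}$ let $\tilde\theta^\star=2\phi_\alpha-\theta^\star$ be the reflection of $\theta^\star$ through the direction $\phi_\alpha$. Let $\widetilde\chi_{\Delta,L}$ be the indicator that $|\theta_{\boldsymbol r}-\theta^\star|<\Delta$ (mod $2\pi$) for all $\boldsymbol r$ with even $\alpha$-th coordinate and $|\theta_{\boldsymbol r}-\tilde\theta^\star|<\Delta$ for all $\boldsymbol r$ with odd $\alpha$-th coordinate, and $\widetilde F^{(\Delta,\alpha)}_{L,\beta}(\theta^\star)=-\frac12\log\frac{\beta J}{2\pi}-\frac1{L^3}\log\int_{[0,2\pi)^{\mathbb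 T_L}}e^{-\beta\mathscr H_L}\widetilde\chi_{\Delta,L}\prod d\theta_{\boldsymbol r}$. Let $q_1=\sin^2\theta^\star$, $q_2=\sin^2(\theta^\star-\tfrac{2\pi}3)$, $q_3=\sin^2(\theta^\star+\tfrac{2\pi}3)$, $E_\gamma=|1-e^{ik_\gamma}|^2$, $E^\star_\gamma=|1+e^{ik_\gamma}|^2$. For $\alpha$ with the other two indices $\beta',\gamma'$ taken cyclically (i.e. $(\alpha,\beta',\gamma')\in\{(1,2,3),(2,3,1),(3,1,2)\}$), set $q_\pm=\frac12(q_{\beta'}\pm q_{\gamma'})$ and $\Pi_\alpha(\boldsymbol k)=\begin{pmatrix}q_\alpha E_\alpha+q_+(E_{\beta'}+E_{\gamma'})& q_-(E_{\beta'}-E_{\gamma'})\\ q_-(E_{\beta'}-E_{\gamma'})& q_\alpha E^\star_\alpha+q_+(E_{\beta'}+E_{\gamma'})\end{pmatrix}$. Finally $\widetilde F_\alpha(\theta^\star)=\frac14\int_{[-\pi,\pi]^3}\frac{d\boldsymbol k}{(2\pi)^3}\log\det\Pi_\alpha(\boldsymbol k)$. *)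

(* Defs.v *)
From HB Require Import structures.
From mathcomp Require Import all_boot all_order all_algebra.
From mathcomp Require Import all_classical all_reals all_analysis.
Set Implicit Arguments. Unset Strict Implicit. Unset Printing Implicit Defensive.
Import Order.TTheory GRing.Theory Num.Theory.
Local Open Scope classical_set_scope.
Local Open Scope ring_scope.

Section Model.
Variable R : realType.

(* Sites of the torus T_L = Z^3/(LZ)^3: triples of coordinates in 'I_L,
   indexed by gamma : 'I_3 (0-based: gamma = 0,1,2 stands for 1,2,3). *)
Definition site (L : nat) := {ffun 'I_3 -> 'I_L}.

Definition shift L (g : 'I_3) (r : site L) : site L :=
  [ffun i => if i == g then ordS (r i) else r i].

Definition phi (g : 'I_3) : R :=
  if val g == 0%N then 0 else if val g == 1%N then 2 * pi / 3 else - (2 * pi / 3).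

Definition Ham L (J : R) (th : site L -> R) : R :=
  J / 2 * \sum_(r : site L) \sum_(g < 3)
     (cos (th r - phi g) - cos (th (shift g r) - phi g)) ^+ 2.

Definition close_mod (x y D : R) : Prop :=
  exists n : int, `|x - y - n%:~R * (2 * pi)| < D.

Definition refl_ang (a : 'I_3) (ts : R) : R := 2 * phi a - ts.

Definition chi_set L (D ts : R) (a : 'I_3) : set (site L -> R) :=
  [set th | forall r : site L,
     if odd (r a) then close_mod (th r) (refl_ang a ts) D
     else close_mod (th r) ts D].

Fixpoint iint (T : eqType) (s : seq T) (f : (T -> R) -> \bar R) (th : T -> R)
    : \bar R :=
  match s with
  | [::] => f th
  | x :: s' => (\int[lebesgue_measure]_(t in `[0%R, (2 * pi)%R[)
                  iint s' f (fun y => if y == x then t else th y))%E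
  end.

Definition Zpart L (J beta D ts : R) (a : 'I_3) : \bar R :=
  iint (enum (site L))
    (fun th => (expR (- (beta * Ham J th)) * \1_(@chi_set L D ts a) th)%:E)
    (fun _ => 0).

Definition Ftilde_L L (J beta D ts : R) (a : 'I_3) : R :=
  - (1 / 2) * ln (beta * J / (2 * pi))
  - (L%:R ^+ 3)^-1 * ln (fine (Zpart L J beta D ts a)).

Definition q (ts : R) (g : 'I_3) : R := sin (ts - phi g) ^+ 2.

(* E_gamma = |1 - e^{ik}|^2, E*_gamma = |1 + e^{ik}|^2 *)
Definition Ek (k : R) : R := (1 - cos k) ^+ 2 + sin k ^+ 2.
Definition Esk (k : R) : R := (1 + cos k) ^+ 2 + sin k ^+ 2.

Definition nxt (g : 'I_3) : 'I_3 := ordS g.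

Definition kcomp (k : (R * R) * R) (g : 'I_3) : R :=
  if val g == 0%N then k.1.1 else if val g == 1%N then k.1.2 else k.2.

Definition Pi_mx (ts : R) (a : 'I_3) (k : (R * R) * R) : 'M[R]_2 :=
  let b := nxt a in let c := nxt (nxt a) in
  let qp := (q ts b + q ts c) / 2 in
  let qm := (q ts b - q ts c) / 2 in
  let Ea := Ek (kcomp k a) in let Eb := Ek (kcomp k b) in
  let Ec := Ek (kcomp k c) in let Esa := Esk (kcomp k a) in
  \matrix_(i < 2, j < 2)
    if (val i == 0%N) && (val j == 0%N) then q ts a * Ea + qp * (Eb + Ec)
    else if (val i == 1%N) && (val j == 1%N) then q ts a * Esa + qp * (Eb + Ec)
    else qm * (Eb - Ec).

Definition elog (x : R) : \bar R := if x <= 0 then -oo%E else (ln x)%:E.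

Definition cube : set ((R * R) * R) :=
  [set k | k.1.1 \in `[- pi, pi] /\ k.1.2 \in `[- pi, pi] /\ k.2 \in `[- pi, pi]].

Definition Ftilde (ts : R) (a : 'I_3) : \bar R :=
  ((1 / 4 / (2 * pi) ^+ 3)%:E *
   \int[(lebesgue_measure \x lebesgue_measure) \x lebesgue_measure]_(k in cube)
      elog (\det (Pi_mx ts a k)))%E.

End Model.

(* Main.v *)
Require Import Defs.
From HB Require Import structures.
From mathcomp Require Import all_boot all_order all_algebra.
From mathcomp Require Import all_classical all_reals all_analysis.
From mathcomp Require Import measurable_realfun ring lra zify.
Set Implicit Arguments. Unset Strict Implicit. Unset Printing Implicit Defensive.
Import Order.TTheory GRing.Theory Num.Theory.
Import numFieldNormedType.Exports.
Local Open Scope classical_set_scope.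
Local Open Scope ring_scope.

(** On the support of the indicator write each angle as its ground-state value
    plus a deviation [x_r], [|x_r| < D]. Expanding the cosines, [beta H] is at
    least [(beta J / 2) Q(x)] minus [O(beta J D^3)] per site, with [Q] a sum of
    squares of linear forms on bonds. [Q] may have zero modes, but adding
    [lam |x|^2] costs only [beta J lam D^2 / 2] per site, which is negligible
    since [lam] may depend on [beta], [J] and [D]. The remaining Gaussian
    integral is at most [(2 pi / (beta J))^(N/2) det(Q + lam)^(-1/2)].

    The real (Hartley) Fourier transform turns [Q + lam] into [D + E P], where
    [P] shifts the [a]-th momentum by [pi]; hence [det(Q + lam)^2] is the product
    over momenta of [det(Pi + lam)]. As [lam > 0], [ln det(Pi + lam)] is
    Lipschitz, so the mean of its values converges to its average over the cube,
    which dominates that of [ln det Pi]. *)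

(** * Schur complements and determinants of list-indexed matrices *)

Section SeqMatrix.
Variables (R : fieldType) (T : eqType).
Implicit Types (u : seq T) (A B : T -> T -> R).

(** [iint] integrates angle by angle over one period, along a list, while the indicator sees angles
    only modulo [2 * pi]. Each deviation is therefore wrapped into [[-pi, pi)], and matrices are
    indexed by lists so that the Gaussian is integrated by eliminating one variable after another:
    every elimination is a Schur complement, and the pivots multiply up to the determinant. This
    step uses only monotonicity of integrals and one-dimensional normal densities. The factor 1/4 in
    the limit has two sources: the Gaussian gives [det^(-1/2)], and only [det^2] is a product over
    all momenta, because reflecting every other layer couples each momentum to its translate by
    [pi], so that each pair is counted twice. The error constants are uniform in [ts] and [a], which
    is why [delta] depends on [eps] alone. [lam] and the threshold on [L] may depend on [beta] and
    [J], since these are fixed along the limit. The regulator also disposes of the points where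
    [ln det Pi] is [-oo]: no integrability is established, only an upper bound by step functions
    built from the regularised logarithm. *)

Definition seqmx u A : 'M[R]_(size u) :=
  \matrix_(i, j) A (tnth (in_tuple u) i) (tnth (in_tuple u) j).

Definition schur A x : T -> T -> R :=
  fun i j => A i j - A i x * A x j / A x x.

(** Block LU factorisation: the left factor is unipotent, so only the pivot and the Schur complement
    contribute. *)
Lemma det_block_schur n (a : R) (b : 'rV[R]_n) (c : 'cV[R]_n) (M : 'M[R]_n) : a != 0 ->
  \det (block_mx a%:M b c M) = a * \det (M - a^-1 *: (c *m b)).
Proof.
move=> a0.
have -> : block_mx a%:M b c M =
    block_mx 1%:M 0 (a^-1 *: c) 1%:M *m block_mx a%:M b 0 (M - a^-1 *: (c *m b)).
  rewrite mulmx_block !mul1mx !mul0mx !addr0 -scalemxAl mul_mx_scalar.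
  by rewrite scalerA mulVf// scale1r -scalemxAl addrC subrK.
by rewrite det_mulmx det_lblock !det1 !mul1r det_ublock det_scalar1.
Qed.

Lemma det_seqmx_cons x u A : A x x != 0 ->
  \det (seqmx (x :: u) A) = A x x * \det (seqmx u (schur A x)).
Proof.
move=> a0.
pose b : 'rV_(size u) := \row_j A x (tnth (in_tuple u) j).
pose c : 'cV_(size u) := \col_i A (tnth (in_tuple u) i) x.
have tn0 : tnth (in_tuple (x :: u)) (lshift (size u) (0 : 'I_1)) = x.
  by rewrite (tnth_nth x).
have tnS i : tnth (in_tuple (x :: u)) (rshift 1 i) = tnth (in_tuple u) i.
  by rewrite !(tnth_nth x).
have -> : seqmx (x :: u) A = block_mx (A x x)%:M b c (seqmx u A).
  pose M : 'M[R]_(1 + size u) := seqmx (x :: u) A.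
  have ulM : ulsubmx M = (A x x)%:M.
    by apply/matrixP => i j; rewrite !mxE !ord1 eqxx mulr1n tn0.
  have urM : ursubmx M = b.
    by apply/matrixP => i j; rewrite !mxE ord1 tn0 tnS.
  have dlM : dlsubmx M = c.
    by apply/matrixP => i j; rewrite !mxE ord1 tn0 tnS.
  have drM : drsubmx M = seqmx u A.
    by apply/matrixP => i j; rewrite !mxE !tnS.
  by rewrite -ulM -urM -dlM -drM submxK.
rewrite det_block_schur//; congr (_ * \det _).
by apply/matrixP => i j; rewrite !mxE big_ord1 !mxE /schur mulrC.
Qed.

End SeqMatrix.

(** * Matrices over a finite type; the determinant of a twisted diagonal matrix *)

Section FinMatrix.
Variables (R : fieldType) (T : finType) (u : seq T).
Hypothesis uE : perm_eq u (enum T).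
Implicit Types (A B : T -> T -> R).

Definition fmul A B : T -> T -> R := fun i j => \sum_k A i k * B k j.
Definition fdiag (d : T -> R) : T -> T -> R := fun i j => d i *+ (i == j).

Lemma sum_tnth_enum (F : T -> R) :
  \sum_(i < size u) F (tnth (in_tuple u) i) = \sum_i F i.
Proof.
rewrite -(big_tuple _ _ (in_tuple u) xpredT) /= (perm_big _ uE) /=.
by rewrite big_enum.
Qed.

Lemma seqmxM A B : seqmx u A *m seqmx u B = seqmx u (fmul A B).
Proof.
apply/matrixP => i j; rewrite !mxE.
under eq_bigr do rewrite !mxE.
exact: (sum_tnth_enum (fun k => A (tnth (in_tuple u) i) k *
  B k (tnth (in_tuple u) j))).
Qed.

Lemma det_fmul A B :
  \det (seqmx u (fmul A B)) = \det (seqmx u A) * \det (seqmx u B).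
Proof. by rewrite -seqmxM det_mulmx. Qed.

Lemma eq_seqmx A B : (forall i j, A i j = B i j) -> seqmx u A = seqmx u B.
Proof. by move=> AB; apply/matrixP => i j; rewrite !mxE AB. Qed.

Lemma det_fdiag (d : T -> R) : \det (seqmx u (fdiag d)) = \prod_i d i.
Proof.
have -> : seqmx u (fdiag d) = diag_mx (\row_i d (tnth (in_tuple u) i)).
  apply/matrixP => i j; rewrite !mxE /fdiag; congr (_ *+ _).
  rewrite (tnth_nth (tnth (in_tuple u) i)) [in RHS]/eq_op /=.
  rewrite [X in _ == X](tnth_nth (tnth (in_tuple u) i)) /= nth_uniq//.
  by rewrite (perm_uniq uE) enum_uniq.
rewrite det_diag; under eq_bigr do rewrite mxE.
rewrite -(big_tuple _ _ (in_tuple u) xpredT) /= (perm_big _ uE) /=.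
by rewrite big_enum.
Qed.

Lemma size_perm_enum : size u = #|T|.
Proof. by rewrite (perm_size uE) cardE. Qed.

Lemma det_seqmxZ (k : R) A :
  \det (seqmx u (fun i j => k * A i j)) = k ^+ #|T| * \det (seqmx u A).
Proof.
rewrite -size_perm_enum -detZ; congr (\det _).
by apply/matrixP => i j; rewrite !mxE.
Qed.

(* For [B = D + E P] with an involution [P] commuting with [E], conjugation by
   the sign-twisted [P] turns [B] into [P D P - E P], and the product of the two
   is diagonal. *)
Lemma det_twisted_sqr (f : T -> T) (d e s : T -> R) : involutive f ->
  (forall k, e (f k) = e k) -> (forall k, s (f k) = - s k) ->
  (forall k, s k ^+ 2 = 1) ->
  \det (seqmx u (fun i j => d i *+ (i == j) + e i *+ (f i == j))) ^+ 2 =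
  \prod_k (d k * d (f k) - e k ^+ 2).
Proof.
move=> ff ef sf s2.
set B := (fun i j => _).
pose B' : T -> T -> R := fun i j => d (f i) *+ (i == j) - e i *+ (f i == j).
pose U : T -> T -> R := fun i j => s i *+ (f i == j).
have mulB (g : T -> T) (c : T -> R) (X : T -> T -> R) i j :
    \sum_k (c i *+ (g i == k)) * X k j = c i * X (g i) j.
  rewrite (bigD1 (g i))//= eqxx big1 ?addr0// => k.
  by rewrite eq_sym => /negPf ->; rewrite mulr0n mul0r.
have mulD (c1 c2 : T -> R) (X : T -> T -> R) i j :
    \sum_k (c1 i *+ (i == k) + c2 i *+ (f i == k)) * X k j =
    c1 i * X i j + c2 i * X (f i) j.
  under eq_bigr do rewrite mulrDl.
  by rewrite big_split /= (mulB id) (mulB f).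
have BB' : seqmx u (fmul B B') = seqmx u (fdiag (fun k => d k * d (f k) - e k ^+ 2)).
  apply: eq_seqmx => i j; rewrite /fmul mulD /B' /fdiag ff ef.
  by case: (i == j); case: (f i == j); rewrite ?mulr1n ?mulr0n; ring.
have UB : seqmx u (fmul U B) = seqmx u (fmul B' U).
  apply: eq_seqmx => i j; rewrite /fmul mulB /B /B'.
  under [RHS]eq_bigr do rewrite -mulNrn.
  have /= -> := mulD (fun i => d (f i)) (fun i => - e i) U i j.
  rewrite /U ff ef sf.
  by case: (i == j); case: (f i == j); rewrite ?mulr1n ?mulr0n; ring.
(* [s] changes sign along [f], so the square of [U] is minus the identity; hence [U] is invertible
   and can be cancelled in [UB]. *)
have UU : seqmx u (fmul U U) = seqmx u (fdiag (fun=> -1)).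
  apply: eq_seqmx => i j; rewrite /fmul mulB /U ff sf mulrnAr mulrN -expr2 s2.
  by [].
have U0 : \det (seqmx u U) != 0.
  have := congr1 determinant UU; rewrite det_fmul det_fdiag => /esym UUE.
  apply/eqP => U0; move: UUE; rewrite U0 mul0r => /eqP/prodf_eq0[k _].
  by rewrite oppr_eq0 oner_eq0.
have detB' : \det (seqmx u B) = \det (seqmx u B').
  have := congr1 determinant UB; rewrite !det_fmul => UBE.
  by apply: (mulfI U0); rewrite UBE mulrC.
by rewrite expr2 {2}detB' -det_fmul BB' det_fdiag.
Qed.

End FinMatrix.

(** * Monotonicity of the integral *)

Section Integral.
Context d (T : measurableType d) (R : realType).
Variable mu : {measure set T -> \bar R}.
Local Open Scope ereal_scope.
Implicit Types (D : set T) (f g : T -> \bar R).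

(* Monotonicity does not need measurability: the integral of a nonnegative
   function is a supremum over the simple functions below it. *)
Lemma ge0_le_integral_nomeas D f g : (forall x, D x -> 0 <= f x) ->
  (forall x, D x -> f x <= g x) ->
  \int[mu]_(x in D) f x <= \int[mu]_(x in D) g x.
Proof.
move=> f0 fg.
have g0 x : D x -> 0 <= g x by move=> Dx; rewrite (le_trans (f0 _ Dx)) ?fg.
rewrite !ge0_integralE//; apply: ge_ereal_sup => _ [h hf <-].
apply: ereal_sup_ubound; exists h => // x; apply: (le_trans (hf x)).
by rewrite /patch; case: ifPn => // /[1!inE] Dx; exact: fg.
Qed.

(** The positive part grows and the negative part shrinks. The signed case is what [elog] calls for,
    as it takes negative values and even [-oo]. *)
Lemma le_integral_nomeas D f g : (forall x, D x -> f x <= g x) ->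
  \int[mu]_(x in D) f x <= \int[mu]_(x in D) g x.
Proof.
move=> fg; rewrite (integralE _ D f) (integralE _ D g).
apply: leeB; apply: ge0_le_integral_nomeas => // x Dx.
- by rewrite !funeposE ge_max !le_max fg//= lexx orbT.
- by rewrite !funenegE ge_max !le_max leeN2 fg//= lexx orbT.
Qed.

End Integral.

(** * Translations of the real line *)

Section Translation.
Variable R : realType.
Local Open Scope ereal_scope.
Local Notation mu := (@lebesgue_measure R).

(** Lebesgue measure is determined by its values on half-open intervals, and interval lengths do not
    change under translation. *)
Lemma lebesgue_measureD (c : R) (A : set R) : measurable A ->
  pushforward mu ((fun x => x + c)%R : _ -> measurableTypeR R) A = mu A.
Proof.
have mD : measurable_fun setT ((fun x => x + c)%R : R -> measurableTypeR R).
  exact: measurable_funD.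
move=> mA; apply/esym/lebesgue_measure_unique => //= _ [[a b]] _ <-.
rewrite /pushforward.
have -> : (fun x => x + c)%R @^-1` `]a, b] = `](a - c)%R, (b - c)%R]%classic.
  by apply/seteqP; split => x /=; rewrite !in_itv/= ltrBlDr lerBrDr.
rewrite !lebesgue_measure_itv/= !lte_fin ltrD2r.
by case: ifP => // _; rewrite -!EFinB; congr EFin; ring.
Qed.

Lemma ge0_integral_translate (f : R -> \bar R) (c a b : R) :
  measurable_fun setT f -> (forall x, 0 <= f x) ->
  \int[mu]_(x in `[a, b[) f (x + c)%R =
  \int[mu]_(x in `[(a + c)%R, (b + c)%R[) f x.
Proof.
move=> mf f0.
have -> : `[a, b[%classic = ((fun x => x + c)%R : R -> measurableTypeR R) @^-1`
    `[(a + c)%R, (b + c)%R[.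
  by apply/seteqP; split => x /=; rewrite !in_itv/= lerD2r ltrD2r.
have mD : measurable_fun [set: measurableTypeR R]
    ((fun x => x + c)%R : measurableTypeR R -> measurableTypeR R).
  exact: measurable_funD.
rewrite -(ge0_integral_pushforward mD _ _ (f := f))//=.
- by apply: eq_measure_integral => //= A mA _; exact: lebesgue_measureD.
- exact: measurable_funS mf.
Qed.

End Translation.

(** * Wrapped angles and the one-variable Gaussian *)

Section Wrap.
Variable R : realType.
Implicit Types (y t : R) (f : R -> R).
Local Notation mu := (@lebesgue_measure R).

(** The representative of [t - y] modulo [2 * pi] in [[-pi, pi)]; it turns closeness on the circle
    into a bound on a real number. *)
Definition wrap_angle y t : R :=
  t - y - (Num.floor ((t - y + pi) / (2 * pi)))%:~R * (2 * pi).

Lemma twopi_gt0 : 0 < 2 * pi :> R.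
Proof. by rewrite mulr_gt0// pi_gt0. Qed.

Lemma wrap_angleE y t (n : int) : - pi <= t - y - n%:~R * (2 * pi) < pi ->
  wrap_angle y t = t - y - n%:~R * (2 * pi).
Proof.
move=> /andP[h1 h2]; rewrite /wrap_angle; congr (_ - _%:~R * _).
apply/floor_def; rewrite ler_pdivlMr ?twopi_gt0// ltr_pdivrMr ?twopi_gt0//.
by rewrite intrD; apply/andP; split; lra.
Qed.

(** Wrapping cuts the period into two intervals and translates them so that they tile [[-pi, pi)];
    the integral of [f] over that interval is then enlarged to the line. *)
Lemma integral_wrap_le y f : measurable_fun setT f -> (forall x, 0 <= f x) ->
  (\int[mu]_(t in `[0%R, (2 * pi)%R[) (f (wrap_angle y t))%:E <= \int[mu]_t (f t)%:E)%E.
Proof.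
move=> mf f0; have p0 := twopi_gt0.
pose n := Num.floor ((0 - y + pi) / (2 * pi)).
(* The wrapped value of the angle 0. Wrapping is [t + c] until this reaches [pi], at [t0], and
   [t + c - 2 * pi] from there on. *)
pose c := - y - n%:~R * (2 * pi) : R.
have [c1 c2] : - pi <= c /\ c < pi.
  have := floor_itv ((0 - y + pi) / (2 * pi)); rewrite -/n.
  rewrite ler_pdivlMr// ltr_pdivrMr// intrD /c => /andP[*].
  by split; lra.
pose t0 := pi - c.
have mfE : measurable_fun setT (EFin \o f) by exact/measurable_EFinP.
have w1 t : t \in `[0, t0[ -> wrap_angle y t = t + c.
  rewrite in_itv/= /t0 => /andP[t1 t2]; rewrite (@wrap_angleE _ _ n) /c; first by ring.
  by move: c1 c2 t1 t2; rewrite /c => c1 c2 t1 t2; apply/andP; split; lra.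
have w2 t : t \in `[t0, 2 * pi[ -> wrap_angle y t = t + (c - 2 * pi).
  rewrite in_itv/= /t0 => /andP[t1 t2].
  rewrite (@wrap_angleE _ _ (n + 1)) /c intrD; first by ring.
  by move: c1 c2 t1 t2; rewrite /c => c1 c2 t1 t2; apply/andP; split; lra.
have mD e : measurable_fun setT (fun t : R => (f (t + e))%:E).
  apply/measurable_EFinP; apply: (measurableT_comp mf).
  exact: measurable_funD.
have sE : `[0, 2 * pi[%classic = `[0, t0[%classic `|` `[t0, 2 * pi[%classic.
  apply/seteqP; split => t /=; rewrite !in_itv/= /t0.
    by move=> /andP[t1 t2]; case: (ltP t (pi - c)) => tc; [left|right]; rewrite ?t1 ?t2.
  by move=> [] /andP[t1 t2]; apply/andP; split; lra.
have e1 : {in `[0, t0[%classic,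
    (fun t : R => (f (t + c))%:E) =1 (fun t => (f (wrap_angle y t))%:E)}.
  by move=> t /[1!inE] /= tI; rewrite w1.
have e2 : {in `[t0, 2 * pi[%classic,
    (fun t : R => (f (t + (c - 2 * pi)))%:E) =1 (fun t => (f (wrap_angle y t))%:E)}.
  by move=> t /[1!inE] /= tI; rewrite w2.
rewrite sE ge0_integral_setU//=; first last.
- apply/eqP/seteqP; split => t //= []; rewrite !in_itv/= => /andP[_ +] /andP[+ _].
  by move=> /lt_le_trans h /h; rewrite ltxx.
- by move=> t _; rewrite lee_fin.
- apply/measurable_funU => //; split.
    by apply: eq_measurable_fun e1 _; exact: measurable_funS (mD _).
  by apply: eq_measurable_fun e2 _; exact: measurable_funS (mD _).
have -> : (\int[mu]_(t in `[0%R, t0[) (f (wrap_angle y t))%:E =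
    \int[mu]_(t in `[0%R, t0[) (EFin \o f) (t + c)%R)%E.
  by apply: eq_integral => t tI; rewrite -e1.
have -> : (\int[mu]_(t in `[t0, (2 * pi)%R[) (f (wrap_angle y t))%:E =
    \int[mu]_(t in `[t0, (2 * pi)%R[) (EFin \o f) (t + (c - 2 * pi))%R)%E.
  by apply: eq_integral => t tI; rewrite -e2.
have f0E x : (0 <= (EFin \o f) x)%E by rewrite lee_fin.
rewrite (@ge0_integral_translate R (EFin \o f) c)//.
rewrite (@ge0_integral_translate R (EFin \o f) (c - 2 * pi))//.
rewrite -ge0_integral_setU//=; first last.
- apply/eqP/seteqP; split => t //= []; rewrite !in_itv/= /t0 => /andP[h1 _] /andP[_ h2].
  by have : False by lra.
- by move=> t _; rewrite lee_fin.
- exact: measurable_funS mfE.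
apply: ge0_subset_integral => //; first exact: measurableU.
by move=> t _; rewrite lee_fin.
Qed.

(** Completing the square yields a multiple of the normal density of mean [- b / a] and variance
    [1 / a]. The remaining [c - b ^+ 2 / a] is the minimum of the polynomial, which is what a Schur
    complement records. *)
Lemma integral_wrap_gauss_le y (K a b c : R) : 0 <= K -> 0 < a ->
  (\int[mu]_(t in `[0%R, (2 * pi)%R[)
     (K * expR (- (a * wrap_angle y t ^+ 2 + 2 * b * wrap_angle y t + c) / 2))%:E <=
   (K * Num.sqrt (2 * pi / a) * expR (- (c - b ^+ 2 / a) / 2))%:E)%E.
Proof.
move=> K0 a0; have p0 := twopi_gt0.
pose C := K * Num.sqrt (2 * pi / a) * expR (- (c - b ^+ 2 / a) / 2).
pose s := (Num.sqrt a)^-1; pose m := - (b / a).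
have sa0 : 0 < Num.sqrt a by rewrite sqrtr_gt0.
have s0 : s != 0 by rewrite invr_neq0// gt_eqF.
have s2 : s ^+ 2 = a^-1 by rewrite exprVn sqr_sqrtr// ltW.
have C0 : 0 <= C by rewrite /C !mulr_ge0// ?sqrtr_ge0// expR_ge0.
have GE x : K * expR (- (a * x ^+ 2 + 2 * b * x + c) / 2) = C * normal_pdf m s x.
  rewrite normal_pdfE// /C /normal_peak /normal_fun s2.
  have -> : a^-1 * pi *+ 2 = 2 * pi / a by rewrite -mulr_natr; field; rewrite gt_eqF.
  have q0 : Num.sqrt (2 * pi / a) != 0 by rewrite gt_eqF// sqrtr_gt0 divr_gt0.
  transitivity (K * expR (- (c - b ^+ 2 / a) / 2 + - (x - m) ^+ 2 / (a^-1 *+ 2))).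
    by congr (K * expR _); rewrite /m -[_ *+ 2]mulr_natr; field; rewrite gt_eqF.
  by rewrite expRD; field.
under eq_integral do rewrite GE.
apply: (le_trans (@integral_wrap_le y (fun x => C * normal_pdf m s x) _ _)).
- by apply: measurable_funM => //; exact: measurable_normal_pdf.
- by move=> x; rewrite mulr_ge0// normal_pdf_ge0.
under eq_integral do rewrite EFinM.
rewrite ge0_integralZl//=.
- by rewrite integral_normal_pdf mule1.
- by apply/measurable_EFinP; exact: measurable_normal_pdf.
- by move=> x _; rewrite lee_fin normal_pdf_ge0.
Qed.

End Wrap.

(** * Quadratic forms and elimination of one variable *)

Section QuadraticForm.
Variables (R : realFieldType) (T : eqType).
Implicit Types (u : seq T) (A : T -> T -> R) (v : T -> R).

Definition qform u A v : R := \sum_(i <- u) \sum_(j <- u) A i j * v i * v j.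

(** Positive definiteness with a margin that elimination preserves: every pivot met on the way is at
    least [lam]. *)
Definition coercive u A (lam : R) : Prop :=
  forall v, lam * (\sum_(i <- u) v i ^+ 2) <= qform u A v.

Definition upd v x t : T -> R := fun y => if y == x then t else v y.

Lemma eq_qform u A v w : {in u, v =1 w} -> qform u A v = qform u A w.
Proof.
move=> vw; apply: eq_big_seq => i iu; apply: eq_big_seq => j ju.
by rewrite !vw.
Qed.

Lemma updE v x t : upd v x t x = t.
Proof. by rewrite /upd eqxx. Qed.

Lemma upd_notin u v x t : x \notin u -> {in u, upd v x t =1 v}.
Proof. by move=> xu i iu; rewrite /upd; case: eqP iu xu => // -> ->. Qed.

Lemma qform_cons x u A v : (forall i j, A i j = A j i) ->
  qform (x :: u) A v =
  A x x * v x ^+ 2 + 2 * (\sum_(j <- u) A x j * v j) * v x + qform u A v.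
Proof.
move=> symA; rewrite /qform big_cons big_cons.
under [X in _ + X = _]eq_bigr do rewrite big_cons.
rewrite big_split/=.
have -> : \sum_(j <- u) A x j * v x * v j = (\sum_(j <- u) A x j * v j) * v x.
  by rewrite mulr_suml; apply: eq_bigr => j _; ring.
have -> : \sum_(j <- u) A j x * v j * v x = (\sum_(j <- u) A x j * v j) * v x.
  by rewrite mulr_suml; apply: eq_bigr => j _; rewrite symA; ring.
ring.
Qed.

Lemma qform_schur x u A v : (forall i j, A i j = A j i) ->
  qform u (schur A x) v =
  qform u A v - (\sum_(j <- u) A x j * v j) ^+ 2 / A x x.
Proof.
move=> symA; rewrite /qform /schur expr2 -mulrA mulr_suml -sumrB.
apply: eq_bigr => i _; rewrite mulrA mulr_sumr mulr_suml -sumrB.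
by apply: eq_bigr => j _; rewrite (symA i x); ring.
Qed.

Lemma coercive_diag x u A lam : x \notin u -> (forall i j, A i j = A j i) ->
  coercive (x :: u) A lam -> lam <= A x x.
Proof.
move=> xu symA /(_ (upd (fun=> 0) x 1)).
rewrite qform_cons// big_cons updE expr1n !mulr1.
have z0 : {in u, upd (fun=> 0) x 1 =1 (fun=> 0 : R)} by exact: upd_notin.
rewrite (eq_qform _ z0) /qform big1_seq ?addr0; last first.
  by move=> i /andP[_ /z0->]; rewrite expr0n.
rewrite big1_seq ?addr0; last by move=> i /andP[_ /z0->]; rewrite mulr0.
rewrite big1 ?mulr0 ?addr0 ?mulr1//.
by move=> i _; rewrite big1// => j _; rewrite mulr0.
Qed.

(* The Schur complement is the form minimised over the eliminated variable. *)
Lemma coercive_schur x u A lam : 0 < lam -> x \notin u ->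
  (forall i j, A i j = A j i) ->
  coercive (x :: u) A lam -> coercive u (schur A x) lam.
Proof.
move=> lam0 xu symA cA v.
have a0 : 0 < A x x by rewrite (lt_le_trans lam0)// (coercive_diag xu).
set b := \sum_(j <- u) A x j * v j.
have := cA (upd v x (- b / A x x)).
have vu := upd_notin v (- b / A x x) xu.
rewrite qform_cons// big_cons updE (eq_qform _ vu).
have -> : \sum_(j <- u) A x j * upd v x (- b / A x x) j = b.
  by apply: eq_big_seq => j /vu->.
have -> : \sum_(j <- u) upd v x (- b / A x x) j ^+ 2 = \sum_(j <- u) v j ^+ 2.
  by apply: eq_big_seq => j /vu->.
rewrite qform_schur// -/b => h.
have -> : qform u A v - b ^+ 2 / A x x = A x x * (- b / A x x) ^+ 2 +
    2 * b * (- b / A x x) + qform u A v by field; rewrite gt_eqF.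
apply: le_trans h; by rewrite ler_pM2l// lerDr sqr_ge0.
Qed.

End QuadraticForm.

(** * Iterated integrals: Gaussian upper bound and positivity *)

Section Iint.
Variables (R : realType) (T : eqType).
Implicit Types (s u : seq T) (f g : (T -> R) -> \bar R) (th : T -> R).
Local Open Scope ereal_scope.

Lemma iint_ge0 s f th : (forall th, 0 <= f th) -> 0 <= iint s f th.
Proof.
move=> f0; elim: s th => [//|x s IH] th /=.
by apply: integral_ge0 => t _; exact: IH.
Qed.

Lemma le_iint s f g th : (forall th, 0 <= f th) -> (forall th, f th <= g th) ->
  iint s f th <= iint s g th.
Proof.
move=> f0 fg; elim: s th => [//|x s IH] th /=.
by apply: ge0_le_integral_nomeas => t _; [exact: iint_ge0|exact: IH].
Qed.

(** The recursion of [iint] exposes the outermost variable, whereas elimination starts from the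
    innermost one. *)
Lemma iint_rcons s x f th : iint (rcons s x) f th =
  iint s (fun th => \int[lebesgue_measure]_(t in `[0%R, (2 * pi)%R[)
                      f (upd th x t)) th.
Proof.
elim: s th => [//|y s IH] th /=.
by apply: eq_integral => t _; exact: IH.
Qed.

(** Induction on [u], whose head is the innermost variable of [rev u]. Integrating it out leaves the
    form of the Schur complement and a factor [sqrt (2 pi / A x x)], absorbed into [K]; this is why
    [K] is arbitrary. *)
Lemma iint_gauss_le (y : T -> R) u (A : T -> T -> R) (lam K : R) th :
  uniq u -> (0 < lam)%R -> (0 <= K)%R -> (forall i j, A i j = A j i) ->
  coercive u A lam -> (0 < \det (seqmx u A))%R /\
  iint (rev u) (fun th => (K * expR (-
      qform u A (fun i => wrap_angle (y i) (th i)) / 2))%:E) th <=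
    (K * Num.sqrt ((2 * pi) ^+ size u / \det (seqmx u A)))%:E.
Proof.
move=> uu lam0; elim: u uu A K th => [_|x u IH /= /andP[xu uu]] A K th K0 symA cA.
  rewrite det_mx00; split => //=.
  by rewrite /qform big_nil oppr0 mul0r expR0 expr0 divr1 sqrtr1.
have a0 : (0 < A x x)%R by rewrite (lt_le_trans lam0)// (coercive_diag xu).
have symS i j : schur A x i j = schur A x j i.
  by rewrite /schur (symA i j) (symA i x) (symA x j) [(A x i * _)%R]mulrC.
have cS := coercive_schur lam0 xu symA cA.
have K'0 : (0 <= K * Num.sqrt (2 * pi / A x x))%R by rewrite mulr_ge0 ?sqrtr_ge0.
have [d0 IHle] := IH uu _ _ th K'0 symS cS.
have detE : \det (seqmx (x :: u) A) = (A x x * \det (seqmx u (schur A x)))%R.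
  by rewrite det_seqmx_cons ?gt_eqF.
have p0 := twopi_gt0 R.
split; first by rewrite detE mulr_gt0.
rewrite rev_cons iint_rcons.
have -> : (K * Num.sqrt ((2 * pi) ^+ (size u).+1 / \det (seqmx (x :: u) A)) =
    K * Num.sqrt (2 * pi / A x x) *
    Num.sqrt ((2 * pi) ^+ size u / \det (seqmx u (schur A x))))%R.
  rewrite -mulrA -sqrtrM ?divr_ge0 ?ltW// detE exprS.
  by congr (_ * Num.sqrt _)%R; field; rewrite !gt_eqF.
apply: le_trans IHle; apply: le_iint => {}th.
  by apply: integral_ge0 => t _; rewrite lee_fin mulr_ge0// expR_ge0.
set w : T -> R := fun i => wrap_angle (y i) (th i).
rewrite qform_schur//; set b := (\sum_(j <- u) A x j * w j)%R.
apply: le_trans (integral_wrap_gauss_le (y x) b (qform u A w) K0 a0).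
rewrite le_eqVlt; apply/orP; left; apply/eqP.
apply: eq_integral => t _; congr (K * expR (- _ / 2))%:E.
have wE : {in u, (fun i => wrap_angle (y i) (upd th x t i)) =1 w}.
  by move=> i iu; rewrite (upd_notin _ _ xu).
rewrite qform_cons// (eq_qform _ wE) updE; congr (_ + 2 * _ * _ + _)%R.
by apply: eq_big_seq => j /wE->.
Qed.

(** Each integration costs the positive factor [lebesgue_measure (B x)]. The variables not yet
    integrated, those outside [s], have to be kept in their sets [B r]. *)
Lemma iint_ge s f (B : T -> set R) (c : R) : (0 < c)%R ->
  (forall th, 0 <= f th) ->
  (forall r, measurable (B r : set (measurableTypeR R))) ->
  (forall r, exists2 m : R, (0 < m)%R & lebesgue_measure (B r) = m%:E) ->
  (forall r, B r `<=` `[0%R, (2 * pi)%R[) ->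
  (forall th, (forall r, B r (th r)) -> c%:E <= f th) ->
  exists2 c' : R, (0 < c')%R &
    forall th, (forall r, r \notin s -> B r (th r)) -> c'%:E <= iint s f th.
Proof.
move=> c0 f0 mB muB BI fc; elim: s => [|x s [c' c'0 IH]].
  by exists c => // th hth; apply: fc => r; exact: hth.
have [m m0 mE] := muB x.
exists (c' * m)%R => [|th hth]; first exact: mulr_gt0.
have -> : (c' * m)%:E = \int[lebesgue_measure]_(t in `[0%R, (2 * pi)%R[)
    (c'%:E * (\1_(B x) t)%:E).
  rewrite ge0_integralZl//=.
  - rewrite integral_indic//=.
    rewrite (_ : (_ `&` _)%classic = B x); last exact/setIidPl.
    by rewrite EFinM -mE.
  - by apply/measurable_EFinP; apply: measurable_indic; exact: mB.
  - by rewrite lee_fin ltW.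
apply: ge0_le_integral_nomeas => t _ /=.
  by rewrite -EFinM lee_fin mulr_ge0// ltW.
rewrite indicE; case: (boolP (t \in B x)) => tB; last first.
  by rewrite mule0; exact: iint_ge0.
rewrite mule1; apply: IH => r rs; case: eqP => [->|/eqP rx].
  by move: tB; rewrite inE.
by apply: hth; rewrite inE negb_or rx.
Qed.

End Iint.

(** * Periodicity and vanishing trigonometric sums *)

Section Trigonometry.
Variable R : realType.
Implicit Types x y : R.

Lemma cosD2piz x (n : int) : cos (x + n%:~R * (2 * pi)) = cos x.
Proof.
have H (m : nat) y : cos (y + m%:R * (2 * pi)) = cos y.
  rewrite -[RHS](periodicn (@cosD2pi R) m); congr cos.
  by ring.
case: n => n; first exact: H.
by rewrite -[LHS](H n.+1) NegzE mulrNz; congr cos; rewrite mulNr subrK.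
Qed.

Lemma sinD2piz x (n : int) : sin (x + n%:~R * (2 * pi)) = sin x.
Proof.
by rewrite -!cosBpihalf -[RHS](cosD2piz _ n); congr cos; ring.
Qed.

Lemma cosDnpi x (n : nat) : cos (x + n%:R * pi) = (-1) ^+ n * cos x.
Proof.
elim: n x => [|n IH] x; first by rewrite mul0r addr0 expr0 mul1r.
have -> : x + n.+1%:R * pi = (x + n%:R * pi) + pi.
  by rewrite -natr1; ring.
by rewrite cosDpi IH exprS mulN1r mulNr.
Qed.

Lemma sinDnpi x (n : nat) : sin (x + n%:R * pi) = (-1) ^+ n * sin x.
Proof. by rewrite -!cosBpihalf -cosDnpi; congr cos; ring. Qed.

Lemma cos_neq1 x : 0 < `|x| < 2 * pi -> cos x != 1.
Proof.
wlog x0 : x / 0 <= x.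
  move=> H; case: (leP 0 x) => [|x0] hx; first exact: H.
  by rewrite -cosN; apply: H; rewrite ?normrN// oppr_ge0 ltW.
rewrite ger0_norm// => /andP[xp x2].
have -> : x = (x / 2) *+ 2 by rewrite -mulr_natr; field.
rewrite cos_mulr2n cos2sin2.
have s0 : 0 < sin (x / 2) by rewrite sin_gt0_pi//; apply/andP; split; lra.
have : 0 < sin (x / 2) ^+ 2 by rewrite exprn_gt0.
by move=> s2; apply/eqP => E; move: E; rewrite -mulr_natr => E; lra.
Qed.

(* Both sums are components of a plane vector fixed by a nontrivial rotation. *)
Lemma rotation_sum_eq0 (T : finType) (f : T -> T) (psi : T -> R) (eta : R) :
  bijective f -> cos eta != 1 ->
  (forall r, cos (psi (f r)) = cos (psi r + eta)) ->
  (forall r, sin (psi (f r)) = sin (psi r + eta)) ->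
  \sum_r cos (psi r) = 0 /\ \sum_r sin (psi r) = 0.
Proof.
move=> bf eta1 cf sf.
set C := \sum_r cos (psi r); set S := \sum_r sin (psi r).
have CE : C = C * cos eta - S * sin eta.
  rewrite {1}/C (reindex f) /=; last exact: onW_bij.
  under eq_bigr do rewrite cf cosD.
  by rewrite sumrB -!mulr_suml.
have SE : S = S * cos eta + C * sin eta.
  rewrite {1}/S (reindex f) /=; last exact: onW_bij.
  under eq_bigr do rewrite sf sinD.
  by rewrite big_split/= -!mulr_suml.
(* The determinant of the identity minus the rotation by [eta]. *)
have d0 : (1 - cos eta) ^+ 2 + sin eta ^+ 2 != 0.
  have : 0 < (1 - cos eta) ^+ 2.
    by rewrite exprn_even_gt0//= subr_eq0 eq_sym.
  by move=> ?; rewrite gt_eqF// ltr_pwDl// sqr_ge0.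
split; apply: (mulIf d0); rewrite mul0r.
  transitivity ((C - (C * cos eta - S * sin eta)) * (1 - cos eta) -
    (S - (S * cos eta + C * sin eta)) * sin eta); first by ring.
  by rewrite -CE -SE !subrr !mul0r subrr.
transitivity ((S - (S * cos eta + C * sin eta)) * (1 - cos eta) +
    (C - (C * cos eta - S * sin eta)) * sin eta); first by ring.
by rewrite -CE -SE !subrr !mul0r addr0.
Qed.

End Trigonometry.

(** * The Hartley transform on the discrete torus *)

Section Hartley.
Variables (R : realType) (h : nat).
Hypothesis h_gt0 : (0 < h)%N.
Local Notation L := (2 * h)%N.
Local Notation shift := Defs.shift.
Implicit Types (k r : site L) (g a : 'I_3).

Definition unshift g r : site L :=
  [ffun i => if i == g then ord_pred (r i) else r i].

Lemma shiftK g : cancel (@shift L g) (unshift g).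
Proof.
by move=> r; apply/ffunP => i; rewrite !ffunE; case: eqP => // _; rewrite ordSK.
Qed.

Lemma unshiftK g : cancel (unshift g) (@shift L g).
Proof.
by move=> r; apply/ffunP => i; rewrite !ffunE; case: eqP => // _; rewrite ord_predK.
Qed.

Lemma shift_bij g : bijective (@shift L g).
Proof. by exists (unshift g); [exact: shiftK|exact: unshiftK]. Qed.

Lemma odd_shift g a r : odd (shift g r a) = (a == g) (+) odd (r a).
Proof.
rewrite ffunE; case: eqP => [_|//] /=.
by rewrite odd_mod ?oddM.
Qed.

(** Equal to [2 * pi * (m - h) / L], a lattice momentum because [L = 2 * h]. Starting at [- pi]
    makes these values the left ends of cells that tile the integration range. *)
Definition momentum (m : 'I_L) : R := 2 * pi * m%:R / L%:R - pi.

Definition phase k r : R := \sum_g momentum (k g) * (r g)%:R.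

Definition hartley k r : R := cos (phase k r) + sin (phase k r).

Lemma h_neq0 : h%:R != 0 :> R.
Proof. by rewrite pnatr_eq0 -lt0n. Qed.

Lemma phase_shift g k r : exists n : int,
  phase k (shift g r) = phase k r + momentum (k g) + n%:~R * (2 * pi).
Proof.
rewrite /phase (bigD1 g)//= [X in exists n, _ = X + _ + _](bigD1 g)//=.
have -> : \sum_(i < 3 | i != g) momentum (k i) * (shift g r i)%:R =
    \sum_(i < 3 | i != g) momentum (k i) * (r i)%:R.
  by apply: eq_bigr => i /negPf ig; rewrite ffunE ig.
set X := \sum_(i < 3 | _) _; rewrite ffunE eqxx /=.
have := ltn_ord (r g); rewrite leq_eqVlt => /predU1P[rL|rL].
  (* Crossing the boundary subtracts [L] times the momentum, that is [2 * pi * (k g - h)]. *)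
  exists (h%:Z - (k g : nat)%:Z); rewrite rL modnn mulr0.
  have -> : (r g)%:R = L%:R - 1 :> R 
    by have := congr1 (fun n : nat => n%:R : R) rL; rewrite /= -natr1; lra.
  by rewrite /momentum natrM rmorphB /= !pmulrn; field; exact: h_neq0.
by exists 0; rewrite modn_small// -natr1; ring.
Qed.

Lemma cos_phase_shift g k r :
  cos (phase k (shift g r)) = cos (phase k r + momentum (k g)).
Proof. by have [n ->] := phase_shift g k r; rewrite cosD2piz. Qed.

Lemma sin_phase_shift g k r :
  sin (phase k (shift g r)) = sin (phase k r + momentum (k g)).
Proof. by have [n ->] := phase_shift g k r; rewrite sinD2piz. Qed.

(** A single shift mixes [cos + sin] with [cos - sin]; the sum of two opposite shifts acts
    diagonally. This suffices, as the energy form weights both shifts equally. *)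
Lemma hartley_shift g k r :
  hartley k (shift g r) + hartley k (unshift g r) =
  2 * cos (momentum (k g)) * hartley k r.
Proof.
set p := unshift g r; have -> : r = shift g p by rewrite unshiftK.
rewrite /hartley; set m := momentum (k g); set x := phase k p.
have -> : cos (phase k (shift g (shift g p))) = cos (x + m + m).
  by rewrite cos_phase_shift cosD cos_phase_shift sin_phase_shift -cosD.
have -> : sin (phase k (shift g (shift g p))) = sin (x + m + m).
  by rewrite sin_phase_shift sinD cos_phase_shift sin_phase_shift -sinD.
rewrite cos_phase_shift sin_phase_shift -/x -/m.
have -> : cos x = cos (x + m - m) by rewrite addrK.
have -> : sin x = sin (x + m - m) by rewrite addrK.
rewrite (cosD (x + m)) (sinD (x + m)) (cosD (x + m) (- m)) (sinD (x + m) (- m)).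
rewrite cosN sinN; ring.
Qed.

Lemma phase_lin (s : R) k k' : forall r,
  phase k r + s * phase k' r =
  \sum_g (momentum (k g) + s * momentum (k' g)) * (r g)%:R.
Proof.
by move=> r; rewrite /phase mulr_sumr -big_split/=; apply: eq_bigr => g _; ring.
Qed.

Lemma sum_cos_phaseB k k' : k != k' ->
  \sum_r cos (phase k r - phase k' r) = 0.
Proof.
move=> kk'; have [g kg] : exists g, k g != k' g.
  apply/existsP; apply: contraNT kk'; rewrite negb_exists => /forallP H.
  by apply/eqP/ffunP => g; apply/eqP; have := H g; rewrite negbK.
have [] // := @rotation_sum_eq0 R _ (@shift L g)
  (fun r => phase k r - phase k' r) (momentum (k g) - momentum (k' g)).
- exact: shift_bij.
- apply: cos_neq1; rewrite /momentum.
  have -> : 2 * pi * (k g)%:R / L%:R - pi - (2 * pi * (k' g)%:R / L%:R - pi) =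
      2 * pi / L%:R * ((k g)%:R - (k' g)%:R) :> R.
    by rewrite natrM; field; exact: h_neq0.
  have L0 : 0 < L%:R :> R by rewrite ltr0n muln_gt0.
  rewrite normrM gtr0_norm ?divr_gt0 ?twopi_gt0//.
  rewrite mulr_gt0 ?divr_gt0 ?twopi_gt0 ?normr_gt0 ?subr_eq0 ?eqr_nat//=.
  rewrite mulrAC ltr_pdivrMr// ltr_pM2l ?twopi_gt0// ltr_norml.
  have := ltn_ord (k g); have := ltn_ord (k' g); rewrite -!(ltr_nat R).
  have : 0 <= (k g)%:R :> R by []. have : 0 <= (k' g)%:R :> R by [].
  by move=> *; apply/andP; split; lra.
- move=> r; have [n ->] := phase_shift g k r; have [n' ->] := phase_shift g k' r.
  by rewrite -[RHS](cosD2piz _ (n - n')) rmorphB/=; congr cos; ring.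
- move=> r; have [n ->] := phase_shift g k r; have [n' ->] := phase_shift g k' r.
  by rewrite -[RHS](sinD2piz _ (n - n')) rmorphB/=; congr sin; ring.
Qed.

(** If the indices of [k] and [k'] add up to 0 modulo [L] in every coordinate, each phase sum is a
    multiple of [2 * pi] and each sine vanishes. Otherwise a shift in some direction is a nontrivial
    rotation. *)
Lemma sum_sin_phaseD k k' : \sum_r sin (phase k r + phase k' r) = 0.
Proof.
case: (boolP [forall g, (k g + k' g == 0)%N || (k g + k' g == L)%N]).
  move=> /forallP H; apply: big1 => r _.
  have := phase_lin 1 k k' r; rewrite mul1r => ->.
  have -> : \sum_g (momentum (k g) + 1 * momentum (k' g)) * (r g)%:R =
      0 + (- (\sum_g (k g + k' g == 0) * r g)%N%:Z)%:~R * (2 * pi).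
    rewrite add0r rmorphN /= -pmulrn natr_sum mulNr mulr_suml -sumrN.
    apply: eq_bigr => g _; rewrite /momentum mul1r [in RHS]natrM natrM.
    have h0 := h_neq0.
    have := H g; case: eqP => [/eqP + _|_ /= /eqP].
      by rewrite addn_eq0 => /andP[/eqP-> /eqP->] /=; field.
    move=> /(congr1 (fun n => n%:R : R)); rewrite natrD natrM => E.
    have -> : (k g)%:R = 2 * h%:R - (k' g)%:R :> R by lra.
    by rewrite !mul0r oppr0; field.
  by rewrite sinD2piz sin0.
rewrite negb_forall => /existsP[g]; rewrite negb_or => /andP[g0 gL].
have [] // := @rotation_sum_eq0 R _ (@shift L g)
  (fun r => phase k r + phase k' r) (momentum (k g) + momentum (k' g)).
- exact: shift_bij.
- apply: cos_neq1; rewrite /momentum.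
  have -> : 2 * pi * (k g)%:R / L%:R - pi + (2 * pi * (k' g)%:R / L%:R - pi) =
      2 * pi / L%:R * ((k g + k' g)%:R - L%:R) :> R.
    by rewrite natrD natrM; field; exact: h_neq0.
  have L0 : 0 < L%:R :> R by rewrite ltr0n muln_gt0.
  rewrite normrM gtr0_norm ?divr_gt0 ?twopi_gt0//.
  rewrite mulr_gt0 ?divr_gt0 ?twopi_gt0 ?normr_gt0 ?subr_eq0 ?eqr_nat//=.
  rewrite mulrAC ltr_pdivrMr// ltr_pM2l ?twopi_gt0// ltr_norml.
  have := ltn_ord (k g); have := ltn_ord (k' g); rewrite -!(ltr_nat R) natrD.
  have : 0 < (k g)%:R + (k' g)%:R :> R by rewrite -natrD ltr0n lt0n.
  by move=> *; apply/andP; split; lra.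
- move=> r; have [n ->] := phase_shift g k r; have [n' ->] := phase_shift g k' r.
  by rewrite -[RHS](cosD2piz _ (n + n')) rmorphD/=; congr cos; ring.
- move=> r; have [n ->] := phase_shift g k r; have [n' ->] := phase_shift g k' r.
  by rewrite -[RHS](sinD2piz _ (n + n')) rmorphD/=; congr sin; ring.
Qed.

(** The product of two kernels is [cos (x - y) + sin (x + y)]; only the cosine sum survives, and
    only on the diagonal. *)
Lemma hartley_orthogonal k k' :
  \sum_r hartley k r * hartley k' r = (#|site L|%:R) *+ (k == k').
Proof.
have -> : \sum_r hartley k r * hartley k' r =
    \sum_r cos (phase k r - phase k' r) + \sum_r sin (phase k r + phase k' r).
  rewrite -big_split/=; apply: eq_bigr => r _.
  by rewrite /hartley cosB sinD; ring.
rewrite sum_sin_phaseD addr0; case: (eqVneq k k') => [->|/sum_cos_phaseB//].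
under eq_bigr do rewrite subrr cos0.
by rewrite sumr_const.
Qed.

Lemma det_hartley_neq0 (u : seq (site L)) : perm_eq u (enum (site L)) ->
  \det (seqmx u hartley) != 0.
Proof.
move=> uE.
have : \det (seqmx u (fmul hartley (fun i j => hartley j i))) != 0.
  rewrite (@eq_seqmx _ _ u _ (fdiag (fun=> #|site L|%:R))); last first.
    exact: hartley_orthogonal.
  rewrite det_fdiag//; apply/prodf_neq0 => k _.
  by rewrite pnatr_eq0 -lt0n; apply/card_gt0P; exists k.
by rewrite det_fmul// mulf_eq0 negb_or => /andP[].
Qed.

End Hartley.

(** * Regularised sums of squares of linear forms *)

Section Gram.
Variables (R : realFieldType) (T I : finType) (lam : R) (ell : I -> T -> R).
Implicit Types v w : T -> R.

Definition gram (i j : T) : R := lam *+ (i == j) + \sum_x ell x i * ell x j.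

Lemma gram_sym i j : gram i j = gram j i.
Proof.
rewrite /gram eq_sym; congr (_ + _); apply: eq_bigr => x _; exact: mulrC.
Qed.

Lemma gram_mul w i :
  \sum_j w j * gram j i = lam * w i + \sum_x (\sum_j ell x j * w j) * ell x i.
Proof.
rewrite /gram; under eq_bigr do rewrite mulrDr.
rewrite big_split/=; congr (_ + _).
  rewrite (bigD1 i)//= eqxx mulr1n mulrC big1 ?addr0// => j /negPf->.
  by rewrite mulr0n mulr0.
under eq_bigr do rewrite mulr_sumr.
rewrite exchange_big/=; apply: eq_bigr => x _; rewrite mulr_suml.
by apply: eq_bigr => j _; ring.
Qed.

Lemma qform_gram (u : seq T) v : perm_eq u (enum T) ->
  qform u gram v = lam * (\sum_(i <- u) v i ^+ 2) +
    \sum_x (\sum_j ell x j * v j) ^+ 2.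
Proof.
move=> uE; rewrite /qform !(perm_big _ uE) /= !big_enum /=.
under eq_bigr => i _.
  rewrite (perm_big _ uE) /= big_enum /=.
  rewrite (_ : \sum_j _ = v i * \sum_j v j * gram j i); last first.
    by rewrite mulr_sumr; apply: eq_bigr => j _; rewrite (gram_sym i j); ring.
  rewrite gram_mul mulrDr; over.
rewrite big_split/=; congr (_ + _).
  by rewrite mulr_sumr; apply: eq_bigr => i _; ring.
under eq_bigr do rewrite mulr_sumr.
rewrite exchange_big/=; apply: eq_bigr => x _.
rewrite expr2 [in RHS]mulr_sumr; apply: eq_bigr => i _; ring.
Qed.

Lemma gram_coercive (u : seq T) : perm_eq u (enum T) -> coercive u gram lam.
Proof.
by move=> uE v; rewrite qform_gram// lerDl sumr_ge0// => x _; exact: sqr_ge0.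
Qed.

End Gram.

(** * The three directions under reflection *)

Section Angles.
Variable R : realType.
Implicit Types (a g : 'I_3) (ts : R).

Lemma nxt_neq a : [/\ nxt a != a, nxt (nxt a) != a & nxt (nxt a) != nxt a].
Proof. by case: a => -[|[|[|]]]. Qed.

Lemma nxt_cases a g : [|| g == a, g == nxt a | g == nxt (nxt a)].
Proof. by case: a g => -[|[|[|]]]// ? [] -[|[|[|]]]. Qed.

Lemma sum_nxt (V : nmodType) (F : 'I_3 -> V) a :
  \sum_g F g = F a + F (nxt a) + F (nxt (nxt a)).
Proof.
have [n1 n2 n3] := nxt_neq a.
rewrite (bigD1 a)//= (bigD1 (nxt a))//= (bigD1 (nxt (nxt a)))//=; last first.
  by rewrite n2.
rewrite big1 ?addr0 ?addrA// => g.
by have := nxt_cases a g; case: eqP => //=; case: eqP => //=; case: eqP.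
Qed.

(** The three directions add up to 0, so the left side is [3 * phi a]. Hence the reflection through
    [a] exchanges the other two directions modulo [2 * pi]. *)
Lemma phi_sum a : exists n : int,
  2 * phi R a - phi R (nxt a) - phi R (nxt (nxt a)) = n%:~R * (2 * pi).
Proof.
case: a => -[|[|[|]]]// i; rewrite /phi/=.
- by exists 0; ring.
- by exists 1; field.
- by exists (- 1); rewrite rmorphN rmorph1; field.
Qed.

Lemma sin_refl_self ts a : sin (refl_ang a ts - phi R a) = - sin (ts - phi R a).
Proof. by rewrite -sinN; congr sin; rewrite /refl_ang; ring. Qed.

Lemma cos_refl_self ts a : cos (refl_ang a ts - phi R a) = cos (ts - phi R a).
Proof. by rewrite -[RHS]cosN; congr cos; rewrite /refl_ang; ring. Qed.

Lemma sin_refl_nxt ts a : sin (refl_ang a ts - phi R (nxt a)) ^+ 2 = q ts (nxt (nxt a)).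
Proof.
have [n nE] := phi_sum a; rewrite /q -[RHS]sqrrN -sinN.
by rewrite -[in RHS](sinD2piz _ n) -nE; congr (sin _ ^+ 2); rewrite /refl_ang; ring.
Qed.

Lemma sin_refl_nxt2 ts a : sin (refl_ang a ts - phi R (nxt (nxt a))) ^+ 2 = q ts (nxt a).
Proof.
have [n nE] := phi_sum a; rewrite /q -[RHS]sqrrN -sinN.
by rewrite -[in RHS](sinD2piz _ n) -nE; congr (sin _ ^+ 2); rewrite /refl_ang; ring.
Qed.

Lemma EkE (x : R) : Ek x = 2 - 2 * cos x.
Proof.
transitivity (1 - 2 * cos x + (cos x ^+ 2 + sin x ^+ 2)); first by rewrite /Ek; ring.
by rewrite cos2Dsin2; ring.
Qed.

Lemma EskE (x : R) : Esk x = 2 + 2 * cos x.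
Proof.
transitivity (1 + 2 * cos x + (cos x ^+ 2 + sin x ^+ 2)); first by rewrite /Esk; ring.
by rewrite cos2Dsin2; ring.
Qed.

End Angles.

(** * The linearised energy and its momentum representation *)

Section SpinWave.
Variables (R : realType) (h : nat).
Hypothesis h_gt0 : (0 < h)%N.
Local Notation L := (2 * h)%N.
Local Notation shift := Defs.shift.
Variables (ts : R) (a : 'I_3).
Implicit Types (k r p : site L) (g : 'I_3).

Definition ground_angle r : R := if odd (r a) then refl_ang a ts else ts.
(** Minus the derivative of [cos (theta - phi g)] at the ground-state angle: the coefficient of the
    deviation in the linearised bond. *)
Definition slope g r : R := sin (ground_angle r - phi R g).

Lemma ground_angle_shift g r : g != a -> ground_angle (shift g r) = ground_angle r.
Proof. by move=> ga; rewrite /ground_angle odd_shift eq_sym (negPf ga). Qed.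

Lemma slope_shift g r : g != a -> slope g (shift g r) = slope g r.
Proof. by move=> ga; rewrite /slope ground_angle_shift. Qed.

Lemma slope_shift_self r : slope a (shift a r) = - slope a r.
Proof.
rewrite /slope /ground_angle odd_shift eqxx /=.
by case: odd => /=; rewrite sin_refl_self ?opprK.
Qed.

(** The ground state has zero energy: the zeroth-order terms cancel across each bond. *)
Lemma cos_ground_angle_shift g r :
  cos (ground_angle (shift g r) - phi R g) = cos (ground_angle r - phi R g).
Proof.
case: (eqVneq g a) => [->|ga]; last by rewrite ground_angle_shift.
rewrite /ground_angle odd_shift eqxx /=.
by case: odd => /=; rewrite cos_refl_self.
Qed.

Let b := nxt a.
Let c := nxt (nxt a).
Let qp : R := (q ts b + q ts c) / 2.
Let qm : R := (q ts b - q ts c) / 2.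

Lemma slope_self_sqr r : slope a r ^+ 2 = q ts a.
Proof. by rewrite /slope /ground_angle; case: odd; rewrite // sin_refl_self sqrrN. Qed.

(** Odd layers see [c] in place of [b], so the squared slope alternates along [a]: [qp] is its mean
    and [qm] the staggered amplitude. *)
Lemma slope_nxt_sqr r : slope b r ^+ 2 = qp + (-1) ^+ odd (r a) * qm.
Proof.
rewrite /slope /ground_angle /qp /qm; case: odd; rewrite ?expr1 ?expr0.
  by rewrite sin_refl_nxt -/c; field.
by rewrite -/(q ts b); field.
Qed.

Lemma slope_nxt2_sqr r : slope c r ^+ 2 = qp - (-1) ^+ odd (r a) * qm.
Proof.
rewrite /slope /ground_angle /qp /qm; case: odd; rewrite ?expr1 ?expr0.
  by rewrite sin_refl_nxt2 -/b; field.
by rewrite -/(q ts c); field.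
Qed.

Definition bond (x : site L * 'I_3) (r : site L) : R :=
  slope x.2 x.1 *+ (x.1 == r)
  - slope x.2 (shift x.2 x.1) *+ (shift x.2 x.1 == r).

Lemma sum_bond x (v : site L -> R) : \sum_r bond x r * v r =
  slope x.2 x.1 * v x.1 - slope x.2 (shift x.2 x.1) * v (shift x.2 x.1).
Proof.
rewrite /bond; under eq_bigr do rewrite mulrBl.
rewrite sumrB; congr (_ - _).
  rewrite (bigD1 x.1)//= eqxx mulr1n big1 ?addr0// => j /negPf.
  by rewrite eq_sym => ->; rewrite mulr0n mul0r.
rewrite (bigD1 (shift x.2 x.1))//= eqxx mulr1n big1 ?addr0// => j /negPf.
by rewrite eq_sym => ->; rewrite mulr0n mul0r.
Qed.

Variable lam : R.
Definition spinwave : site L -> site L -> R := gram lam bond.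

Lemma spinwave_mul (w : site L -> R) r : \sum_p w p * spinwave p r =
  lam * w r + \sum_g slope g r * (2 * slope g r * w r
    - slope g (shift g r) * w (shift g r)
    - slope g (unshift g r) * w (unshift g r)).
Proof.
rewrite gram_mul; congr (_ + _).
under eq_bigr do rewrite sum_bond.
pose F p g := (slope g p * w p - slope g (shift g p) * w (shift g p)) * bond (p, g) r.
rewrite -(pair_bigA _ F) exchange_big/=; apply: eq_bigr => g _.
rewrite /F /bond/=; under eq_bigr do rewrite mulrBr.
rewrite sumrB (bigD1 r)//= eqxx mulr1n big1 ?addr0; last first.
  by move=> p /negPf->; rewrite mulr0n mulr0.
rewrite (bigD1 (unshift g r))//= unshiftK eqxx mulr1n big1 ?addr0; last first.
  move=> p /negPf pr; rewrite (_ : (Defs.shift g p == r) = false) ?mulr0n ?mulr0//.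
  by apply: contraFF pr => /eqP<-; rewrite shiftK.
ring.
Qed.

Definition halfturn (m : 'I_L) : 'I_L :=
  Ordinal (ltn_pmod (m + h) (leq_ltn_trans (leq0n m) (ltn_ord m))).

Definition flip k : site L := [ffun i => if i == a then halfturn (k i) else k i].

Lemma halfturnK : involutive halfturn.
Proof.
move=> m; apply/val_inj => /=; rewrite modnDml -addnA addnn -mul2n modnDr.
by rewrite modn_small.
Qed.

Lemma flipK : involutive flip.
Proof.
by move=> k; apply/ffunP => i; rewrite !ffunE; case: eqP => // _; rewrite halfturnK.
Qed.

Lemma halfturnE (m : 'I_L) :
  halfturn m = (if (m < h)%N then m + h else m - h)%N :> nat.
Proof.
have mL := ltn_ord m; rewrite /=; case: ltnP => mh.
  by rewrite modn_small//; lia.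
have -> : (m + h = m - h + L)%N by lia.
by rewrite modnDr modn_small//; lia.
Qed.

Lemma momentum_halfturn (m : 'I_L) : exists n : int,
  momentum R (halfturn m) = momentum R m + pi + n%:~R * (2 * pi).
Proof.
rewrite /momentum halfturnE; have h0 := h_neq0 R h_gt0; case: ltnP => mh.
  by exists 0; rewrite natrD natrM; field.
by exists (-1); rewrite natrB// natrM rmorphN rmorph1; field.
Qed.

Lemma cos_momentum_halfturn (m : 'I_L) :
  cos (momentum R (halfturn m)) = - cos (momentum R m).
Proof. by have [n ->] := momentum_halfturn m; rewrite cosD2piz cosDpi. Qed.

(** The sign [(-1) ^ (r a)] is itself a plane wave of momentum [pi]. Through it the staggered
    coefficients couple [k] to [flip k] and to nothing else. *)
Lemma hartley_flip k r :
  hartley R (flip k) r = (-1) ^+ odd (r a) * hartley R k r.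
Proof.
have [n nE] : exists n : int,
    phase R (flip k) r = phase R k r + (r a)%:R * pi + n%:~R * (2 * pi).
  have [n nE] := momentum_halfturn (k a).
  exists (n * (r a : nat)%:Z); rewrite /phase (bigD1 a)//= [in RHS](bigD1 a)//=.
  rewrite !ffunE eqxx nE rmorphM/= -pmulrn.
  rewrite (eq_bigr (fun i => momentum R (k i) * (r i)%:R)); first by ring.
  by move=> i /negPf ia; rewrite ffunE ia.
by rewrite /hartley nE cosD2piz sinD2piz cosDnpi sinDnpi -mulrDr signr_odd.
Qed.

(** [Esk] stands in direction [a] because the slope changes sign there; at [flip k] it becomes [Ek],
    which gives the other diagonal entry of the two-by-two block. *)
Definition diag_sym k : R := lam + q ts a * Esk (momentum R (k a)) +
  qp * (Ek (momentum R (k b)) + Ek (momentum R (k c))).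
Definition off_sym k : R := qm * (Ek (momentum R (k b)) - Ek (momentum R (k c))).

Lemma spinwave_hartley k r : \sum_p hartley R k p * spinwave p r =
  diag_sym k * hartley R k r + off_sym k * hartley R (flip k) r.
Proof.
rewrite (spinwave_mul (hartley R k)) (sum_nxt _ a) -/b -/c hartley_flip.
have [ba ca _] := nxt_neq a; rewrite -/b -/c in ba ca.
have ush g : g != a -> slope g (unshift g r) = slope g r.
  by move=> ga; rewrite -[in RHS](unshiftK g r) slope_shift.
have usha : slope a (unshift a r) = - slope a r.
  by rewrite -[in RHS](unshiftK a r) slope_shift_self opprK.
rewrite (slope_shift r ba) (slope_shift r ca) (ush _ ba) (ush _ ca).
rewrite slope_shift_self usha.
have HS g := hartley_shift R h_gt0 g k r.
have -> : slope a r * (2 * slope a r * hartley R k r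
    - - slope a r * hartley R k (shift a r)
    - - slope a r * hartley R k (unshift a r)) =
    slope a r ^+ 2 * (2 * hartley R k r +
      (hartley R k (shift a r) + hartley R k (unshift a r))) by ring.
have E g : slope g r * (2 * slope g r * hartley R k r
    - slope g r * hartley R k (shift g r)
    - slope g r * hartley R k (unshift g r)) =
    slope g r ^+ 2 * (2 * hartley R k r -
      (hartley R k (shift g r) + hartley R k (unshift g r))) by ring.
rewrite !E !HS slope_self_sqr slope_nxt_sqr slope_nxt2_sqr.
rewrite /diag_sym /off_sym !EkE EskE.
ring.
Qed.

Lemma det_spinwave_sqr (u : seq (site L)) : perm_eq u (enum (site L)) ->
  \det (seqmx u spinwave) ^+ 2 =
  \prod_k (diag_sym k * diag_sym (flip k) - off_sym k ^+ 2).
Proof.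
move=> uE.
have [ba ca _] := nxt_neq a; rewrite -/b -/c in ba ca.
(* A sign that is odd under [flip]: [halfturn] exchanges the two halves of the range of [k a]. *)
pose s k : R := if (k a < h)%N then 1 else -1.
have offf k : off_sym (flip k) = off_sym k.
  by rewrite /off_sym !ffunE (negPf ba) (negPf ca).
have sf k : s (flip k) = - s k.
  rewrite /s ffunE eqxx halfturnE; have := ltn_ord (k a); case: (ltnP (k a) h) => kh kL.
    by rewrite (_ : (_ < h)%N = false)//; lia.
  by rewrite (_ : (_ < h)%N = true) ?opprK//; lia.
have s2 k : s k ^+ 2 = 1 by rewrite /s; case: ifP; rewrite ?expr1n ?sqrrN ?expr1n.
rewrite -(det_twisted_sqr uE diag_sym flipK offf sf s2); congr (_ ^+ 2).
set B := (fun i j => _).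
(* The transform intertwines [spinwave] with [B]; its nonzero determinant cancels. *)
apply: (mulfI (det_hartley_neq0 R h_gt0 uE)).
rewrite -det_fmul// mulrC -det_fmul//; congr (\det _).
apply: eq_seqmx => k r; rewrite /fmul spinwave_hartley /B.
under eq_bigr do rewrite mulrDl.
rewrite big_split/=; congr (_ + _).
  rewrite (bigD1 k)//= eqxx mulr1n big1 ?addr0// => j /negPf.
  by rewrite eq_sym => ->; rewrite mulr0n mul0r.
rewrite (bigD1 (flip k))//= eqxx mulr1n big1 ?addr0// => j /negPf.
by rewrite eq_sym => ->; rewrite mulr0n mul0r.
Qed.

End SpinWave.

(** * The regularised two-by-two determinant *)

Section Symbol.
Variables (R : realType) (ts : R) (a : 'I_3) (lam : R).
Local Notation kcomp := Defs.kcomp.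

(** The determinant of [Pi_mx ts a k] with [lam] added on the diagonal. Being defined at all real
    momenta, it serves both the lattice product and the integral. *)
Definition det_sym (k : (R * R) * R) : R :=
  let b := nxt a in let c := nxt (nxt a) in
  let X := (q ts b + q ts c) / 2 * (Ek (kcomp k b) + Ek (kcomp k c)) in
  (lam + q ts a * Ek (kcomp k a) + X) * (lam + q ts a * Esk (kcomp k a) + X)
  - ((q ts b - q ts c) / 2 * (Ek (kcomp k b) - Ek (kcomp k c))) ^+ 2.

Definition kvec h (k : site (2 * h)) : (R * R) * R :=
  (momentum R (k 0), momentum R (k 1), momentum R (k 2)).

Lemma kcomp_kvec h (k : site (2 * h)) g : kcomp (kvec k) g = momentum R (k g).
Proof.
by case: g => -[|[|[|]]]// i; rewrite /kcomp/=; congr (momentum _ (k _)); exact/val_inj.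
Qed.

Lemma det_spinwave h (u : seq (site (2 * h))) : (0 < h)%N ->
  perm_eq u (enum (site (2 * h))) ->
  \det (seqmx u (spinwave ts a lam)) ^+ 2 = \prod_(k : site (2 * h)) det_sym (kvec k).
Proof.
move=> h0 uE; rewrite det_spinwave_sqr//; apply: eq_bigr => k _.
have [ba ca _] := nxt_neq a.
rewrite /det_sym /diag_sym /off_sym !kcomp_kvec !ffunE eqxx (negPf ba) (negPf ca).
rewrite [Esk (momentum R (halfturn _))]EskE cos_momentum_halfturn// (EkE (momentum R (k a))).
ring.
Qed.

End Symbol.

(** * Taylor bounds and the linearisation of one bond *)

Section TaylorBounds.
Variable R : realType.
Implicit Types x y : R.

Lemma mvt_le (f df : R -> R) (M x y : R) : x <= y ->
  (forall z : R, is_derive z 1 f (df z)) ->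
  (forall z, x <= z <= y -> `|df z| <= M) -> `|f y - f x| <= M * (y - x).
Proof.
move=> xy fdf dfM.
have [|c cI ->] := @MVT_segment R f df x y xy (fun z _ => fdf z).
  apply: derivable_within_continuous => z _; exact: ex_derive.
rewrite normrM [`|y - x|]ger0_norm ?subr_ge0// ler_wpM2r ?subr_ge0//.
by apply: dfM; rewrite in_itv in cI.
Qed.

Lemma sin_lip0 x : 0 <= x -> `|sin x| <= x.
Proof.
move=> x0; have := @mvt_le sin cos 1 0 x x0 (@is_derive_sin R).
rewrite sin0 !subr0 mul1r; apply => z _; exact: cos_max.
Qed.

Lemma cos_lip x y : `|cos x - cos y| <= `|x - y|.
Proof.
wlog yx : x y / y <= x.
  move=> H; case: (leP y x) => [/H//|/ltW/H].
  by rewrite distrC [in leRHS]distrC.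
rewrite [leRHS]ger0_norm ?subr_ge0//.
have := @mvt_le cos (fun z => - sin z) 1 y x yx (@is_derive_cos R).
by rewrite mul1r; apply => z _; rewrite normrN; exact: sin_max.
Qed.

Lemma cos_ge_sqr x : 1 - cos x <= x ^+ 2 / 2.
Proof.
wlog x0 : x / 0 <= x.
  move=> H; case: (leP 0 x) => [/H//|x0]; rewrite -cosN -sqrrN.
  by apply: H; rewrite oppr_ge0 ltW.
have -> : cos x = 1 - 2 * sin (x / 2) ^+ 2.
  have {1}-> : x = (x / 2) *+ 2 by rewrite -mulr_natr; field.
  by rewrite cos_mulr2n cos2sin2 -mulr_natr; ring.
have x20 : 0 <= x / 2 by rewrite divr_ge0.
have : sin (x / 2) ^+ 2 <= (x / 2) ^+ 2.
  by rewrite -real_normK ?num_real// lerXn2r ?nnegrE//; exact: sin_lip0.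
have -> : (x / 2) ^+ 2 = x ^+ 2 / 4 by field.
by move=> ?; lra.
Qed.

Lemma sin_sub_le x : `|x - sin x| <= `|x| ^+ 3 / 2.
Proof.
wlog x0 : x / 0 <= x.
  move=> H; case: (leP 0 x) => [/H//|x0].
  rewrite -normrN opprB addrC -[sin x]opprK -sinN -[`|x|]normrN; apply: H.
  by rewrite oppr_ge0 ltW.
rewrite (ger0_norm x0).
have dz (z : R) : is_derive z 1 (fun z => z - sin z) (1 - cos z) by exact: is_deriveB.
have := @mvt_le _ _ (x ^+ 2 / 2) 0 x x0 dz.
rewrite sin0 !subr0 => /(_ _)/le_trans; apply.
  move=> z /andP[z0 zx]; rewrite ger0_norm ?subr_ge0 ?cos_le1//.
  apply: le_trans (cos_ge_sqr z) _.
  by rewrite ler_pM2r ?invr_gt0// lerXn2r ?nnegrE.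
by rewrite (_ : x ^+ 2 / 2 * x = x ^+ 3 / 2)//; field.
Qed.

(* With [D < 1] the linearised bond differs from the true one by at most
   [3 D^2 / 2], and both are at most of order [D]. *)
Lemma bond_lower (c s s' x x' D : R) : `|c| <= 1 -> `|s| <= 1 -> `|s'| <= 1 ->
  0 < D -> D < 1 -> `|x| < D -> `|x'| < D ->
  (s * x - s' * x') ^+ 2 - 6 * D ^+ 3 <=
  ((c * cos x - s * sin x) - (c * cos x' - s' * sin x')) ^+ 2.
Proof.
move=> c1 s1 s'1 D0 D1 xD x'D.
pose err := c * (cos x - cos x') + s * (x - sin x) - s' * (x' - sin x').
pose l := s * x - s' * x'.
have -> : (c * cos x - s * sin x) - (c * cos x' - s' * sin x') = err - l.
  by rewrite /err /l; ring.
rewrite -/l.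
have sq z : `|z| < D -> z ^+ 2 <= D ^+ 2.
  by move=> zD; rewrite -real_normK ?num_real// lerXn2r ?nnegrE// ltW.
have D2 : 0 <= D ^+ 2 by exact: sqr_ge0.
have D32 : D ^+ 3 <= D ^+ 2 by rewrite exprSr ler_piMr// ltW.
have cz z : `|z| < D -> 1 - D ^+ 2 / 2 <= cos z <= 1.
  move=> /sq zD; rewrite cos_le1 andbT; have := cos_ge_sqr z; lra.
have sz z : `|z| < D -> `|z - sin z| <= D ^+ 2 / 2.
  move=> zD; apply: le_trans (sin_sub_le z) _; rewrite ler_pM2r ?invr_gt0//.
  by apply: le_trans D32; rewrite lerXn2r ?nnegrE// ltW.
have m1 (A B M : R) : `|A| <= 1 -> `|B| <= M -> `|A * B| <= M.
  by move=> A1 BM; rewrite normrM -[M]mul1r ler_pM.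
have e1 : `|err| <= 3 / 2 * D ^+ 2.
  have h1 : `|c * (cos x - cos x')| <= D ^+ 2 / 2.
    apply: m1 => //; rewrite ler_norml.
    by move: (cz _ xD) (cz _ x'D) => /andP[? ?] /andP[? ?]; apply/andP; split; lra.
  have h2 := m1 _ _ _ s1 (sz _ xD).
  have h3 := m1 _ _ _ s'1 (sz _ x'D).
  move: h1 h2 h3; rewrite /err !ler_norml => /andP[? ?] /andP[? ?] /andP[? ?].
  by apply/andP; split; lra.
have l1 : `|l| <= 2 * D.
  have h2 := m1 _ _ _ s1 (ltW xD).
  have h3 := m1 _ _ _ s'1 (ltW x'D).
  move: h2 h3; rewrite /l !ler_norml => /andP[? ?] /andP[? ?].
  by apply/andP; split; lra.
have le : `|err * l| <= 3 * D ^+ 3.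
  rewrite normrM (_ : 3 * D ^+ 3 = 3 / 2 * D ^+ 2 * (2 * D)); last by field.
  by rewrite ler_pM.
have := sqr_ge0 err.
move: le; rewrite ler_norml => /andP[_ h2] h3.
(* The square of the error is dropped; the cross term, twice [3 * D ^+ 3], gives the constant 6. *)
have -> : (err - l) ^+ 2 = err ^+ 2 - 2 * (err * l) + l ^+ 2 by ring.
by lra.
Qed.

End TaylorBounds.

(** * Upper bound and positivity of the partition function *)

Section Partition.
Variables (R : realType) (h : nat).
Hypothesis h_gt0 : (0 < h)%N.
Local Notation L := (2 * h)%N.
Local Notation shift := Defs.shift.
Variables (ts : R) (a : 'I_3) (J beta D lam : R).
Hypotheses (J0 : 0 < J) (beta0 : 0 < beta) (D0 : 0 < D) (D1 : D < 1).
Hypothesis lam0 : 0 < lam.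
Implicit Types (th : site L -> R) (r : site L).
Local Notation N := #|site L|.

Definition deviation th r : R := wrap_angle (ground_angle ts a r) (th r).

(** Since [D < 1 < pi], the integer witnessing closeness is the one that wrapping subtracts. *)
Lemma close_mod_wrap (x y : R) : close_mod x y D ->
  `|wrap_angle y x| < D /\ exists n : int, x = y + wrap_angle y x + n%:~R * (2 * pi).
Proof.
move=> [n nD]; have pi2 := pi_ge2 R.
have E : wrap_angle y x = x - y - n%:~R * (2 * pi).
  apply: (@wrap_angleE _ _ _ n); move: nD; rewrite ltr_norml.
  move: (x - y - _) => z /andP[z1 z2].
  by apply/andP; split; [apply: ltW|]; move: D1 pi2; lra.
by split; [rewrite E|exists n; rewrite E; ring].
Qed.

Lemma chi_deviation th r : chi_set D ts a th ->
  `|deviation th r| < D /\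
  exists n : int, th r = ground_angle ts a r + deviation th r + n%:~R * (2 * pi).
Proof.
move=> /(_ r); rewrite /deviation /ground_angle; case: odd; exact: close_mod_wrap.
Qed.

(** Three bonds per site, each losing [6 * D ^+ 3], make up the 18. *)
Lemma Ham_lower th : chi_set D ts a th ->
  J / 2 * (\sum_x (\sum_r bond ts a x r * deviation th r) ^+ 2
    - 18 * D ^+ 3 * N%:R) <= Ham J th.
Proof.
move=> chith; rewrite /Ham ler_pM2l ?divr_gt0//.
under eq_bigr do rewrite sum_bond.
rewrite -(pair_bigA _ (fun p g => (slope ts a g p * deviation th p
  - slope ts a g (shift g p) * deviation th (shift g p)) ^+ 2))/=.
have -> : 18 * D ^+ 3 * N%:R = \sum_(r : site L) \sum_(g < 3) 6 * D ^+ 3.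
  by rewrite !sumr_const card_ord -mulr_natr -[in RHS]mulr_natr; ring.
rewrite -sumrB; apply: ler_sum => r _; rewrite -sumrB; apply: ler_sum => g _.
have [xD [n nE]] := chi_deviation r chith.
have [x'D [n' n'E]] := chi_deviation (shift g r) chith.
set x := deviation th r in xD nE *; set x' := deviation th _ in x'D n'E *.
have cE r' z m : cos (ground_angle ts a r' + z + m%:~R * (2 * pi) - phi R g) =
    cos (ground_angle ts a r' - phi R g) * cos z - slope ts a g r' * sin z.
  rewrite /slope -cosD -[RHS](cosD2piz _ m); congr cos; ring.
rewrite nE n'E !cE cos_ground_angle_shift.
by apply: bond_lower => //; rewrite ?cos_max ?sin_max.
Qed.

(** Reversed so that [rev u] is the integration order of [Zpart]. *)
Let u := rev (enum (site L)).
Let uE : perm_eq u (enum (site L)).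
Proof. by rewrite perm_rev. Qed.
Let scaled (i j : site L) : R := beta * J * spinwave ts a lam i j.

Lemma qform_scaled v : qform u scaled v = beta * J * qform u (spinwave ts a lam) v.
Proof.
rewrite /qform mulr_sumr; apply: eq_bigr => i _; rewrite mulr_sumr.
by apply: eq_bigr => j _; rewrite /scaled !mulrA.
Qed.

(** Valid at every configuration, it frees the integrand from the indicator: off the support the
    left side is 0. *)
Lemma boltzmann_le th : expR (- (beta * Ham J th)) * \1_(chi_set D ts a) th <=
  expR (beta * J / 2 * (lam * D ^+ 2 + 18 * D ^+ 3) * N%:R) *
  expR (- qform u scaled (deviation th) / 2).
Proof.
rewrite indicE; case: (boolP (th \in _)) => [/[1!inE] chith|_]; last first.
  by rewrite mulr0 mulr_ge0// expR_ge0.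
rewrite mulr1 -expRD ler_expR qform_scaled qform_gram//.
have bJ0 : 0 < beta * J by rewrite mulr_gt0.
have := Ham_lower chith; set Q := \sum_x _ ^+ 2.
rewrite -(ler_pM2l beta0) => HQ.
have S : \sum_(i <- u) deviation th i ^+ 2 <= D ^+ 2 * N%:R.
  rewrite (perm_big _ uE)/= big_enum/=.
  have -> : D ^+ 2 * N%:R = \sum_(r : site L) D ^+ 2.
    by rewrite sumr_const mulr_natr.
  apply: ler_sum => r _; have [rD _] := chi_deviation r chith.
  by rewrite -real_normK ?num_real// lerXn2r ?nnegrE// ltW.
have : beta * J * lam * (\sum_(i <- u) deviation th i ^+ 2) <=
    beta * J * lam * (D ^+ 2 * N%:R) by rewrite ler_pM2l ?mulr_gt0.
move: HQ; set S' := \sum_(i <- u) _ => HQ HS.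
have -> : - (beta * J * (lam * S' + Q)) / 2 =
    - (beta * (J / 2 * (Q - 18 * D ^+ 3 * N%:R))) - beta * J * lam * S' / 2
    - beta * J / 2 * 18 * D ^+ 3 * N%:R by field.
have -> : beta * J / 2 * (lam * D ^+ 2 + 18 * D ^+ 3) * N%:R =
    beta * J * lam * (D ^+ 2 * N%:R) / 2 + beta * J / 2 * 18 * D ^+ 3 * N%:R by field.
by lra.
Qed.

Lemma Zpart_le : 0 < \det (seqmx u (spinwave ts a lam)) /\
  (Zpart L J beta D ts a <=
   (expR (beta * J / 2 * (lam * D ^+ 2 + 18 * D ^+ 3) * N%:R) *
    Num.sqrt ((2 * pi) ^+ N /
      ((beta * J) ^+ N * \det (seqmx u (spinwave ts a lam)))))%:E)%E.
Proof.
have bJ0 : 0 < beta * J by rewrite mulr_gt0.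
have uu : uniq u by rewrite (perm_uniq uE) enum_uniq.
have symS i j : scaled i j = scaled j i by rewrite /scaled [spinwave _ _ _ i j]gram_sym.
have cS : coercive u scaled (beta * J * lam).
  by move=> v; rewrite qform_scaled -[leLHS]mulrA ler_pM2l//; exact: gram_coercive.
have K0 := expR_ge0 (beta * J / 2 * (lam * D ^+ 2 + 18 * D ^+ 3) * N%:R).
have [] := iint_gauss_le (ground_angle ts a) (fun=> 0) uu (mulr_gt0 bJ0 lam0) K0 symS cS.
have pE : (2 * pi) ^+ size u = (2 * pi) ^+ N :> R by rewrite (size_perm_enum uE).
rewrite det_seqmxZ// pE pmulr_rgt0 ?exprn_gt0// => d0 Zle; split=> //.
apply: le_trans Zle; rewrite /Zpart /u revK; apply: le_iint => th.
  by rewrite lee_fin mulr_ge0// expR_ge0.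
by rewrite lee_fin; exact: boltzmann_le.
Qed.

(** The right half of the neighbourhood of the representative of [y] in [[0, 2 * pi)], cut at
    [2 * pi]; it still has positive measure. *)
Lemma close_interval (y : R) : exists B : set R,
  [/\ measurable (B : set (measurableTypeR R)),
      exists2 m : R, 0 < m & lebesgue_measure B = m%:E,
      B `<=` `[0, 2 * pi[ & B `<=` [set t | close_mod t y D]].
Proof.
have p0 := twopi_gt0 R.
pose n := Num.floor (y / (2 * pi)); pose t0 := y - n%:~R * (2 * pi).
have /andP[t00 t02] : 0 <= t0 < 2 * pi.
  have := floor_itv (y / (2 * pi)); rewrite -/n ler_pdivlMr// ltr_pdivrMr//.
  by rewrite intrD => /andP[? ?]; rewrite /t0; apply/andP; split; lra.
pose e := Num.min (t0 + D) (2 * pi).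
have te : t0 < e by rewrite lt_min t02 andbT ltrDl.
have eD : e <= t0 + D by rewrite ge_min lexx.
have ep : e <= 2 * pi by rewrite ge_min lexx orbT.
exists `[t0, e[%classic; split.
- exact: measurable_itv.
- exists (e - t0); first by rewrite subr_gt0.
  by rewrite lebesgue_measure_itv/= lte_fin te.
- by move=> t /=; rewrite !in_itv/= => /andP[? ?]; apply/andP; split; lra.
- move=> t /=; rewrite in_itv/= => /andP[? ?]; exists (- n).
  rewrite rmorphN /= mulNr opprK ltr_norml.
  by move: (t00) (eD); rewrite /t0 => *; apply/andP; split; rewrite /t0 in te ep *; lra.
Qed.

Lemma Ham_ub th : Ham J th <= J / 2 * (\sum_(r : site L) \sum_(g < 3) 4).
Proof.
rewrite /Ham ler_pM2l ?divr_gt0//; apply: ler_sum => r _; apply: ler_sum => g _.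
set x := cos _; set y := cos _.
have : -1 <= x <= 1 by rewrite cos_geN1 cos_le1.
have : -1 <= y <= 1 by rewrite cos_geN1 cos_le1.
by move=> /andP[? ?] /andP[? ?]; nra.
Qed.

(** Positivity lets the upper bound pass through [ln], which takes a default value at 0. *)
Lemma Zpart_gt0 : (0 < Zpart L J beta D ts a)%E.
Proof.
have /choice[B BP] : forall r : site L, exists B : set R,
  [/\ measurable (B : set (measurableTypeR R)),
      exists2 m : R, 0 < m & lebesgue_measure B = m%:E,
      B `<=` `[0, 2 * pi[ & B `<=` [set t | close_mod t (ground_angle ts a r) D]].
  by move=> r; exact: close_interval.
pose c := expR (- (beta * (J / 2 * (\sum_(r : site L) \sum_(g < 3) 4)))).
have [||||||c' c'0 /(_ (fun=> 0)) H] := @iint_ge R (site L) (enum (site L))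
  (fun th => (expR (- (beta * Ham J th)) * \1_(chi_set D ts a) th)%:E) B c.
- exact: expR_gt0.
- by move=> th; rewrite lee_fin mulr_ge0// expR_ge0.
- by move=> r; have [] := BP r.
- by move=> r; have [] := BP r.
- by move=> r; have [] := BP r.
- move=> th Bth; rewrite lee_fin indicE mem_set ?mulr1; last first.
    move=> r; have [_ _ _ /(_ _ (Bth r))] := BP r.
    by rewrite /ground_angle /=; case: odd.
  by rewrite ler_expR lerN2 ler_pM2l//; exact: Ham_ub.
apply: lt_le_trans (H _); first by rewrite lte_fin.
by move=> r; rewrite mem_enum.
Qed.

End Partition.

(** * Finite-volume lower bound on the free energy *)

Section FreeEnergyBound.
Variable R : realType.
Local Notation kcomp := Defs.kcomp.

Lemma q_ge0 (ts : R) g : 0 <= q ts g. Proof. exact: sqr_ge0. Qed.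

Lemma q_le1 (ts : R) g : q ts g <= 1.
Proof. by rewrite /q sin2cos2 gerBl sqr_ge0. Qed.

Lemma Ek_ge0 (x : R) : 0 <= Ek x. Proof. by rewrite addr_ge0 ?sqr_ge0. Qed.
Lemma Esk_ge0 (x : R) : 0 <= Esk x. Proof. by rewrite addr_ge0 ?sqr_ge0. Qed.

(** [X ^+ 2] minus the squared off-diagonal entry factors as [(qb Eb + qc Ec) (qb Ec + qc Eb)], so
    the determinant is a sum of products of nonnegative terms. *)
Lemma det_sym0_ge0 (ts : R) a k : 0 <= det_sym ts a 0 k.
Proof.
rewrite /det_sym !add0r.
set qa := q ts a; set qb := q ts (nxt a); set qc := q ts (nxt (nxt a)).
set Ea := Ek (kcomp k a); set Es := Esk _; set Eb := Ek _; set Ec := Ek _.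
have [hqa hqb hqc] : [/\ 0 <= qa, 0 <= qb & 0 <= qc] by split; exact: q_ge0.
have [hEa hEs] : 0 <= Ea /\ 0 <= Es by split; [exact: Ek_ge0|exact: Esk_ge0].
have [hEb hEc] : 0 <= Eb /\ 0 <= Ec by split; exact: Ek_ge0.
clearbody qa qb qc Ea Es Eb Ec; set X := (qb + qc) / 2 * (Eb + Ec).
have X0 : 0 <= X by rewrite mulr_ge0 ?divr_ge0 ?addr_ge0.
have -> : (qa * Ea + X) * (qa * Es + X) - ((qb - qc) / 2 * (Eb - Ec)) ^+ 2 =
    qa * Ea * (qa * Es) + X * (qa * Ea + qa * Es) +
    (qb * Eb + qc * Ec) * (qb * Ec + qc * Eb) by rewrite /X; field.
by clearbody X; do ![apply: addr_ge0|apply: mulr_ge0].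
Qed.

(** In the expansion in powers of [lam] the linear coefficient is the trace, which is
    nonnegative. *)
Lemma det_sym_ge (ts : R) a (lam : R) k : 0 <= lam ->
  det_sym ts a 0 k + lam ^+ 2 <= det_sym ts a lam k.
Proof.
move=> lam0; rewrite /det_sym.
set X := (q ts (nxt a) + q ts (nxt (nxt a))) / 2 * _; set W := (_ * (_ - _)) ^+ 2.
set A := q ts a * Ek _; set B := q ts a * Esk _.
have A0 : 0 <= A by rewrite mulr_ge0 ?q_ge0 ?Ek_ge0.
have B0 : 0 <= B by rewrite mulr_ge0 ?q_ge0 ?Esk_ge0.
have X0 : 0 <= X.
  apply: mulr_ge0; last by apply: addr_ge0; exact: Ek_ge0.
  by apply: divr_ge0 => //; apply: addr_ge0; exact: q_ge0.
clearbody A B X W.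
have : 0 <= lam * (A + B + 2 * X) by do ![apply: mulr_ge0|apply: addr_ge0].
by move=> ?; lra.
Qed.

Lemma det_Pi_mx (ts : R) a k : \det (Pi_mx ts a k) = det_sym ts a 0 k.
Proof.
rewrite (expand_det_row _ 0) !big_ord_recl big_ord0 /cofactor !det_mx11 !mxE/=.
rewrite /det_sym; ring.
Qed.

Lemma det_sym_gt0 (ts : R) a (lam : R) k : 0 < lam -> 0 < det_sym ts a lam k.
Proof.
move=> l0; apply: lt_le_trans (det_sym_ge ts a k (ltW l0)).
by rewrite ltr_wpDl ?det_sym0_ge0// exprn_gt0.
Qed.

Lemma ln_prod (T : finType) (f : T -> R) : (forall i, 0 < f i) ->
  ln (\prod_i f i) = \sum_i ln (f i).
Proof.
move=> f0.
suff [] : 0 < \prod_i f i /\ ln (\prod_i f i) = \sum_i ln (f i) by [].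
apply: (big_ind2 (fun x y => 0 < x /\ ln x = y)) => [|x1 x2 y1 y2 [x10 <-] [y10 <-]|i _].
- by rewrite ln1.
- by rewrite mulr_gt0// lnM.
- by [].
Qed.

Lemma card_site L : #|site L| = (L ^ 3)%N.
Proof. by rewrite card_ffun !card_ord. Qed.

(** The powers of [2 * pi / (beta * J)] cancel the normalising term of [Ftilde_L]; [2 * ln d] is the
    sum over momenta, whence the 4 in the denominator. *)
Lemma Ftilde_L_ge h (ts : R) a (J beta D lam : R) : (0 < h)%N ->
  0 < J -> 0 < beta -> 0 < D -> D < 1 -> 0 < lam ->
  (4 * (2 * h)%:R ^+ 3)^-1 * (\sum_(k : site (2 * h)) ln (det_sym ts a lam (kvec R k)))
  - beta * J / 2 * (lam * D ^+ 2 + 18 * D ^+ 3) <=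
  Ftilde_L (2 * h) J beta D ts a.
Proof.
move=> h0 J0 b0 D0 D1 l0.
have bJ0 : 0 < beta * J by rewrite mulr_gt0.
have [] := Zpart_le h ts a J0 b0 D0 D1 l0.
set d := \det _ => d0; set K := beta * J / 2 * _ => Zle.
have Zgt := Zpart_gt0 h ts a J0 b0 D0.
have p0 := twopi_gt0 R.
have NE : #|site (2 * h)|%:R = (2 * h)%:R ^+ 3 :> R by rewrite card_site natrX.
set N := #|site (2 * h)| in Zle NE.
have N0 : 0 < N%:R :> R by rewrite NE exprn_gt0// ltr0n muln_gt0.
have Zfin : Zpart (2 * h) J beta D ts a \is a fin_num.
  by rewrite ge0_fin_numE ?(le_lt_trans Zle) ?ltry// ltW.
have d2 : d ^+ 2 = \prod_(k : site (2 * h)) det_sym ts a lam (kvec R k).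
  by rewrite /d det_spinwave// perm_rev.
have lnd : 2 * ln d = \sum_(k : site (2 * h)) ln (det_sym ts a lam (kvec R k)).
  rewrite -ln_prod; last by move=> k; exact: det_sym_gt0.
  by rewrite -d2 lnXn// mulr_natl.
have Zp : 0 < fine (Zpart (2 * h) J beta D ts a) by rewrite fine_gt0// Zgt ltey_eq Zfin.
set y := (2 * pi) ^+ N / _ in Zle.
have y0 : 0 < y by rewrite divr_gt0 ?mulr_gt0 ?exprn_gt0.
have lny : ln y = N%:R * (ln (2 * pi) - ln (beta * J)) - ln d.
  rewrite /y ln_div ?posrE ?mulr_gt0 ?exprn_gt0// lnM ?posrE ?exprn_gt0//.
  by rewrite !lnXn//; ring.
have lnZ : ln (fine (Zpart (2 * h) J beta D ts a)) <= K * N%:R + ln y / 2.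
  have -> : K * N%:R + ln y / 2 = ln (expR (K * N%:R) * Num.sqrt y).
    rewrite lnM ?posrE ?expR_gt0 ?sqrtr_gt0// expRK; congr (_ + _).
    have sy : 0 < Num.sqrt y by rewrite sqrtr_gt0.
    by rewrite -[in LHS](sqr_sqrtr (ltW y0)) lnXn//; field.
  rewrite ler_ln ?posrE ?mulr_gt0 ?expR_gt0 ?sqrtr_gt0//.
  by rewrite -lee_fin fineK.
rewrite /Ftilde_L -NE -lnd ln_div ?posrE//.
have := lnZ; rewrite -(ler_pM2l (_ : 0 < N%:R^-1)) ?invr_gt0// lny.
have -> : N%:R^-1 * (K * N%:R + (N%:R * (ln (2 * pi) - ln (beta * J)) - ln d) / 2) =
    K + (ln (2 * pi) - ln (beta * J)) / 2 - ln d * N%:R^-1 / 2.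
  by field; rewrite gt_eqF.
have -> : (4 * N%:R)^-1 * (2 * ln d) = ln d * N%:R^-1 / 2 by field; rewrite gt_eqF.
by move=> ?; lra.
Qed.

End FreeEnergyBound.

(** * Integrals of step functions *)

Section StepFunction.
Context d (T : measurableType d) (R : realType).
Variable mu : {measure set T -> \bar R}.
Variables (D : set T) (I : Type) (c m : I -> R) (A : I -> set T).
Hypotheses (mD : measurable D) (mA : forall i, measurable (A i)).
Hypotheses (AD : forall i, A i `<=` D) (muA : forall i, mu (A i) = (m i)%:E).

Lemma integral_indic_sub i : (\int[mu]_(x in D) (\1_(A i) x)%:E = (m i)%:E)%E.
Proof. by rewrite integral_indic// (_ : A i `&` D = A i) ?muA//; exact/setIidPl. Qed.

Lemma integrable_cindic i : mu.-integrable D (fun x => (c i)%:E * (\1_(A i) x)%:E)%E.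
Proof.
apply: integrableZl => //; apply/integrableP; split.
  by apply/measurable_EFinP; exact: measurable_indic.
under eq_integral do rewrite gee0_abs ?lee_fin//.
by rewrite integral_indic_sub ltry.
Qed.

(** Coefficients of either sign and overlapping sets are allowed; the majorant of the logarithm has
    both. *)
Lemma integral_step (s : seq I) :
  (\int[mu]_(x in D) (\sum_(i <- s) c i * \1_(A i) x)%:E =
   (\sum_(i <- s) c i * m i)%:E)%E.
Proof.
elim: s => [|i s IH].
  by rewrite big_nil integral0_eq// => x _; rewrite big_nil.
under eq_integral do rewrite big_cons EFinD EFinM.
rewrite integralD//; first last.
- rewrite (_ : (fun _ => _) = (fun x => \sum_(i <- s) ((c i)%:E * (\1_(A i) x)%:E))%E).
    by apply: integrable_sum => // j _; exact: integrable_cindic.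
  by apply/funext => x; rewrite -sumEFin; apply: eq_bigr => j _; rewrite EFinM.
- exact: integrable_cindic.
rewrite IH integralZl//; last first.
  apply/integrableP; split; first by apply/measurable_EFinP; exact: measurable_indic.
  under eq_integral do rewrite gee0_abs ?lee_fin//.
  by rewrite integral_indic_sub ltry.
by rewrite integral_indic_sub big_cons EFinD EFinM.
Qed.

End StepFunction.

(** * Comparison of the integral with the sum over lattice momenta *)

Section RiemannSum.
Variable R : realType.
Local Notation kcomp := Defs.kcomp.
Implicit Types (ts lam : R) (a : 'I_3) (k : (R * R) * R).

(** To be read with [p = 2 * pi] and [n = L]: [M] enters with opposite signs on the cube and on its
    cells and cancels, and [41 = 164 / 4]. *)
Lemma average_identity (p l n S M : R) : p != 0 -> l != 0 -> n != 0 ->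
  1 / 4 / p ^+ 3 * (- M * p ^+ 3 +
    (S + n ^+ 3 * (164 * (p / n) / l ^+ 2 + M)) * (p / n) ^+ 3) =
  (4 * n ^+ 3)^-1 * S + 41 * (p / n) / l ^+ 2.
Proof. by move=> *; field; apply/and3P. Qed.

Lemma mul_diff_le (x y x' y' M N e f : R) : `|x| <= M -> `|y'| <= N ->
  `|x - x'| <= e -> `|y - y'| <= f -> `|x * y - x' * y'| <= M * f + e * N.
Proof.
move=> xM yN xe yf.
have -> : x * y - x' * y' = x * (y - y') + (x - x') * y' by ring.
by rewrite (le_trans (ler_normD _ _))// !normrM lerD// ler_pM.
Qed.

Lemma ler_norm_fracM (s t S : R) : 0 <= s <= 1 -> `|t| <= S -> `|s * t| <= S.
Proof.
by move=> /andP[s0 s1] tS; rewrite normrM ger0_norm// -[S]mul1r ler_pM.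
Qed.

Lemma diag_entry_le (lam s t v w w' : R) : 0 <= lam <= 1 -> 0 <= s <= 1 ->
  0 <= t <= 1 -> `|v| <= 1 -> `|w| <= 1 -> `|w'| <= 1 ->
  `|lam + s * (2 + 2 * v) + t * ((2 - 2 * w) + (2 - 2 * w'))| <= 13.
Proof.
move=> /andP[l0 l1] sI tI; rewrite !ler_norml => /andP[v0 v1] /andP[w0 w1] /andP[w'0 w'1].
have h1 : `|s * (2 + 2 * v)| <= 4.
  by apply: ler_norm_fracM => //; rewrite ler_norml; apply/andP; split; lra.
have h2 : `|t * ((2 - 2 * w) + (2 - 2 * w'))| <= 8.
  by apply: ler_norm_fracM => //; rewrite ler_norml; apply/andP; split; lra.
move: h1 h2; rewrite !ler_norml => /andP[? ?] /andP[? ?].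
by apply/andP; split; lra.
Qed.

Lemma diag_entry_lip (lam s t v w z v' w' z' e : R) : 0 <= s <= 1 -> 0 <= t <= 1 ->
  `|v - v'| <= e -> `|w - w'| <= e -> `|z - z'| <= e ->
  `|(lam + s * (2 + 2 * v) + t * ((2 - 2 * w) + (2 - 2 * z)))
  - (lam + s * (2 + 2 * v') + t * ((2 - 2 * w') + (2 - 2 * z')))| <= 6 * e.
Proof.
move=> sI tI; rewrite !ler_norml => /andP[v0 v1] /andP[w0 w1] /andP[z0 z1].
have h1 : `|s * (2 * v - 2 * v')| <= 2 * e.
  by apply: ler_norm_fracM => //; rewrite ler_norml; apply/andP; split; lra.
have h2 : `|t * ((2 * w' - 2 * w) + (2 * z' - 2 * z))| <= 4 * e.
  by apply: ler_norm_fracM => //; rewrite ler_norml; apply/andP; split; lra.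
move: h1 h2; rewrite !ler_norml => /andP[? ?] /andP[? ?].
by apply/andP; split; lra.
Qed.

Lemma off_entry_le (t w w' S : R) : `|t| <= 1 / 2 -> `|w' - w| <= S ->
  `|t * ((2 - 2 * w) - (2 - 2 * w'))| <= S.
Proof.
move=> t1 wS.
have -> : t * ((2 - 2 * w) - (2 - 2 * w')) = (2 * t) * (w' - w) by ring.
rewrite normrM -[S]mul1r ler_pM// normrM ger0_norm//.
by move: t1; move: `|t| => x; lra.
Qed.

(** Every entry is affine in cosines, which are 1-Lipschitz. Diagonal entries are bounded by 13 and
    6-Lipschitz, off-diagonal ones bounded by 2 and 2-Lipschitz, whence
    [164 = 2 * 13 * 6 + 2 * 2 * 2]. *)
Lemma det_sym_lip ts a lam k k' (e : R) : 0 <= lam -> lam <= 1 ->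
  (forall g, `|kcomp k g - kcomp k' g| <= e) ->
  det_sym ts a lam k - det_sym ts a lam k' <= 164 * e.
Proof.
move=> l0 l1 ke; have lI : 0 <= lam <= 1 by rewrite l0.
have dE g : `|cos (kcomp k g) - cos (kcomp k' g)| <= e.
  by apply: le_trans (cos_lip _ _) (ke g).
have qI g : 0 <= q ts g <= 1 by rewrite q_ge0 q_le1.
have cI (x : R) : `|cos x| <= 1 by exact: cos_max.
rewrite /det_sym !EkE !EskE.
move: (qI a) (qI (nxt a)) (qI (nxt (nxt a))).
move: (dE a) (dE (nxt a)) (dE (nxt (nxt a))).
move: (cI (kcomp k a)) (cI (kcomp k (nxt a))) (cI (kcomp k (nxt (nxt a)))).
move: (cI (kcomp k' a)) (cI (kcomp k' (nxt a))) (cI (kcomp k' (nxt (nxt a)))).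
move: (q ts a) (q ts (nxt a)) (q ts (nxt (nxt a))) => qa qb qc.
move: (cos (kcomp k a)) (cos (kcomp k (nxt a))) (cos (kcomp k (nxt (nxt a)))) => x y z.
move: (cos (kcomp k' a)) (cos (kcomp k' (nxt a))) (cos (kcomp k' (nxt (nxt a)))) => x' y' z'.
move=> {ke dE qI cI} Ix' Iy' Iz' Ix Iy Iz dx dy dz Iqa /andP[b0 b1] /andP[c0 c1].
have qp1 : 0 <= (qb + qc) / 2 <= 1 by apply/andP; split; lra.
have qm1 : `|(qb - qc) / 2| <= 1 / 2 by rewrite ler_norml; apply/andP; split; lra.
(* [Ek] is [Esk] with the cosine negated, so both diagonal entries go through the same bounds. *)
have xN : `|- x - - x'| <= e by rewrite opprK addrC distrC.
have xNI : `|- x| <= 1 by rewrite normrN.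
have dW : `|(qb - qc) / 2 * ((2 - 2 * y) - (2 - 2 * z))
    - (qb - qc) / 2 * ((2 - 2 * y') - (2 - 2 * z'))| <= 2 * e.
  have -> : (qb - qc) / 2 * ((2 - 2 * y) - (2 - 2 * z))
      - (qb - qc) / 2 * ((2 - 2 * y') - (2 - 2 * z')) =
    (qb - qc) / 2 * ((2 - 2 * (y - y')) - (2 - 2 * (z - z'))) by ring.
  apply: off_entry_le => //.
  by rewrite (le_trans (ler_normB _ _))// mulr2n mulrDl !mul1r lerD.
have W (w w' : R) : `|w| <= 1 -> `|w'| <= 1 ->
    `|(qb - qc) / 2 * ((2 - 2 * w) - (2 - 2 * w'))| <= 2.
  by move=> ? ?; apply: off_entry_le => //; rewrite (le_trans (ler_normB _ _))// lerD.
have H1 := mul_diff_le (diag_entry_le lI Iqa qp1 xNI Iy Iz)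
  (diag_entry_le lI Iqa qp1 Ix' Iy' Iz')
  (diag_entry_lip lam Iqa qp1 xN dy dz) (diag_entry_lip lam Iqa qp1 dx dy dz).
have H2 := mul_diff_le (W _ _ Iy Iz) (W _ _ Iy' Iz') dW dW.
rewrite !mulrN in H1; rewrite !expr2.
move: H1 H2; rewrite !ler_norml => /andP[_ H1] /andP[H2 _].
apply: le_trans (_ : _ <= (13 * (6 * e) + 6 * e * 13) + (2 * (2 * e) + 2 * e * 2)) _.
  rewrite -[X in _ <= _ + X]opprK; apply: le_trans (lerB H1 H2).
  by rewrite le_eqVlt; apply/orP; left; apply/eqP; ring.
by rewrite le_eqVlt; apply/orP; left; apply/eqP; ring.
Qed.

(** [ln (x / y) <= (x - y) / y], and the regulator keeps [y] above [lam ^+ 2]. *)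
Lemma ln_det_sym_lip ts a lam k k' (e : R) : 0 < lam -> lam <= 1 ->
  (forall g, `|kcomp k g - kcomp k' g| <= e) ->
  ln (det_sym ts a lam k) <= ln (det_sym ts a lam k') + 164 * e / lam ^+ 2.
Proof.
move=> l0 l1 ke; have e0 : 0 <= e by apply: le_trans (ke 0).
have := det_sym_lip ts a (ltW l0) l1 ke.
have := det_sym_gt0 ts a k l0; have := det_sym_gt0 ts a k' l0.
have : lam ^+ 2 <= det_sym ts a lam k'.
  by apply: le_trans (det_sym_ge ts a k' (ltW l0)); rewrite lerDr det_sym0_ge0.
set y := det_sym _ _ _ k'; set x := det_sym _ _ _ k => yl y0 x0 xy.
have l20 : 0 < lam ^+ 2 by rewrite exprn_gt0.
have -> : x = y * (1 + (x - y) / y) by field; rewrite gt_eqF.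
have x1 : 0 < 1 + (x - y) / y.
  by rewrite (_ : 1 + (x - y) / y = x / y) ?divr_gt0//; field; rewrite gt_eqF.
rewrite lnM ?posrE// lerD2l.
apply: le_trans (le_ln1Dx _) _; first by lra.
rewrite ler_pdivrMr// (le_trans xy)// mulrAC ler_pdivlMr//.
by apply: ler_wpM2l => //; rewrite mulr_ge0.
Qed.

Lemma elog_le ts a lam k : 0 < lam ->
  (elog (\det (Pi_mx ts a k)) <= (ln (det_sym ts a lam k))%:E)%E.
Proof.
move=> l0; rewrite /elog det_Pi_mx; case: ifPn => [_|]; first exact: leNye.
rewrite -ltNge => d0; rewrite lee_fin ler_ln ?posrE//; last exact: det_sym_gt0.
by apply: le_trans (det_sym_ge ts a k (ltW l0)); rewrite lerDl sqr_ge0.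
Qed.

Variable h : nat.
Hypothesis h_gt0 : (0 < h)%N.
Local Notation L := (2 * h)%N.
Local Notation eta := (2 * pi / L%:R : R).

Lemma momentum_cover (x : R) : - pi <= x <= pi ->
  exists m : 'I_L, momentum R m <= x <= momentum R m + eta.
Proof.
move=> /andP[x1 x2]; have p0 := twopi_gt0 R.
have L0 : 0 < L%:R :> R by rewrite ltr0n muln_gt0.
have e0 : 0 < eta by rewrite divr_gt0.
suff [m /andP[m1 m2]] : exists m : 'I_L, m%:R * eta <= x + pi <= (m%:R + 1) * eta.
  exists m; rewrite /momentum (_ : 2 * pi * m%:R / L%:R = m%:R * eta); last by ring.
  by apply/andP; split; lra.
have z0 : 0 <= (x + pi) / eta by apply: divr_ge0; [lra|exact: ltW].
have /andP[t1 t2] := trunc_itv z0.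
case: (ltnP (Num.trunc ((x + pi) / eta)) L) => tL.
  exists (Ordinal tL); rewrite /=.
  apply/andP; split; first by rewrite -(ler_pdivlMr _ _ e0).
  by rewrite -(ler_pdivrMr _ _ e0) natr1 ltW.
(* Only [x = pi] is left; it belongs to the last closed cell. *)
have Lm : (L.-1 < L)%N by rewrite prednK// muln_gt0.
exists (Ordinal Lm); rewrite /=.
have E : (L.-1%:R + 1) * eta = 2 * pi.
  rewrite natr1 prednK ?muln_gt0//; field.
  by rewrite pnatr_eq0 -lt0n.
rewrite E; apply/andP; split; last by lra.
rewrite -(ler_pdivlMr _ _ e0); apply: le_trans t1; rewrite ler_nat.
by apply: leq_trans tL; exact: leq_pred.
Qed.

Lemma momentum_range (m : 'I_L) : - pi <= momentum R m /\ momentum R m + eta <= pi.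
Proof.
have p0 := twopi_gt0 R.
have L0 : 0 < L%:R :> R by rewrite ltr0n muln_gt0.
have e0 : 0 < eta by rewrite divr_gt0.
rewrite /momentum (_ : 2 * pi * m%:R / L%:R = m%:R * eta); last by ring.
have E : L%:R * eta = 2 * pi by field; exact: h_neq0.
split; first by have := mulr_ge0 (ler0n R m) (ltW e0); lra.
have : (m.+1%:R) * eta <= L%:R * eta by rewrite ler_pM2r// ler_nat.
by rewrite E -natr1; lra.
Qed.

Definition box (b : R) (k : (R * R) * R) : set ((R * R) * R) :=
  (`[k.1.1, k.1.1 + b] `*` `[k.1.2, k.1.2 + b]) `*` `[k.2, k.2 + b].

Local Notation mu3 := ((@lebesgue_measure R \x @lebesgue_measure R) \x @lebesgue_measure R)%E.

Lemma measurable_box b k : measurable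
  (box b k : set ((measurableTypeR R * measurableTypeR R) * measurableTypeR R)).
Proof. by apply: measurableX; [apply: measurableX|]; exact: measurable_itv. Qed.

Lemma box_measure b k : 0 <= b -> mu3 (box b k) = (b ^+ 3)%:E.
Proof.
move=> b0; rewrite /box product_measure1E//; last first.
  by apply: measurableX; exact: measurable_itv.
rewrite /= product_measure1E//=.
have E (x : R) : lebesgue_measure `[x, x + b]%classic = b%:E.
  rewrite lebesgue_measure_itv/= lte_fin ltrDl; case: ltP => [_|bn].
    by rewrite -EFinB addrAC subrr add0r.
  by congr EFin; lra.
by rewrite !E -!EFinM; congr EFin; ring.
Qed.

Lemma cubeE : @cube R = box (2 * pi) (- pi, - pi, - pi).
Proof.
have E : - pi + 2 * pi = pi :> R by ring.
apply/seteqP; split => k; rewrite /cube /box/= E.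
  by move=> [? [? ?]].
by move=> [[? ?] ?].
Qed.

(** The logarithm is majorised by a step function on closed cells, which overlap along faces.
    Writing it as [- M] on the whole cube plus [f m + err + M >= 0] on each cell makes overlaps
    harmless: they only increase the majorant. *)
Lemma Ftilde_le ts a lam : 0 < lam -> lam <= 1 ->
  (Ftilde ts a <=
   ((4 * L%:R ^+ 3)^-1 * (\sum_(k : site L) ln (det_sym ts a lam (kvec R k)))
    + 41 * eta / lam ^+ 2)%:E)%E.
Proof.
move=> l0 l1; have p0 := twopi_gt0 R.
have L0 : 0 < L%:R :> R by rewrite ltr0n muln_gt0.
have e0 : 0 < eta by rewrite divr_gt0.
pose f (m : site L) := ln (det_sym ts a lam (kvec R m)).
pose M := - ln (lam ^+ 2); pose err := 164 * eta / lam ^+ 2.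
have err0 : 0 <= err.
  by apply: divr_ge0; [apply: mulr_ge0 => //; exact: ltW|rewrite exprn_ge0// ltW].
have fM m : 0 <= f m + err + M.
  rewrite addrAC addr_ge0// subr_ge0 ler_ln ?posrE ?exprn_gt0 ?det_sym_gt0//.
  by apply: le_trans (det_sym_ge ts a _ (ltW l0)); rewrite lerDr det_sym0_ge0.
(* [None] stands for the whole cube and carries the compensating constant. *)
pose c (o : option (site L)) := if o is Some m then f m + err + M else - M.
pose A (o : option (site L)) : set ((R * R) * R) :=
  if o is Some m then box eta (kvec R m) else @cube R.
pose v (o : option (site L)) : R := if o is Some _ then eta ^+ 3 else (2 * pi) ^+ 3.
pose s := None :: [seq Some m | m <- enum (site L)].
have le1 : (\int[mu3]_(k in @cube R) elog (\det (Pi_mx ts a k)) <=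
    \int[mu3]_(k in @cube R) (\sum_(o <- s) c o * \1_(A o) k)%:E)%E.
  apply: le_integral_nomeas => k kc; apply: le_trans (elog_le ts a k l0) _.
  rewrite lee_fin big_cons big_map big_enum/= indicE mem_set// mulr1.
  have [k1 [k2 k3]] := kc.
  have [m1 /andP[a1 b1]] := momentum_cover k1.
  have [m2 /andP[a2 b2]] := momentum_cover k2.
  have [m3 /andP[a3 b3]] := momentum_cover k3.
  pose m : site L := [ffun i : 'I_3 =>
    if val i == 0%N then m1 else if val i == 1%N then m2 else m3].
  have kmE : kvec R m = (momentum R m1, momentum R m2, momentum R m3).
    by rewrite /kvec !ffunE.
  rewrite (bigD1 m)//= indicE mem_set ?mulr1; last first.
    by rewrite /box kmE /=; split; [split|]; rewrite /= in_itv/=; apply/andP.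
  have fk : ln (det_sym ts a lam k) <= f m + err.
    apply: ln_det_sym_lip => // g; rewrite kmE.
    by rewrite /kcomp/=; case: ifP => _; [|case: ifP => _];
      rewrite ler_norml; apply/andP; split; lra.
  have : 0 <= \sum_(i | i != m) (f i + err + M) * \1_(box eta (kvec R i)) k.
    by apply: sumr_ge0 => m' _; rewrite mulr_ge0.
  by move=> ?; lra.
have AC o : A o `<=` @cube R.
  case: o => [m|]//= k; rewrite /box/= /kvec/= !in_itv/=.
  have [? ?] := momentum_range (m 0); have [? ?] := momentum_range (m 1).
  have [? ?] := momentum_range (m 2).
  move=> [[/andP[? ?] /andP[? ?]] /andP[? ?]].
  by rewrite /cube/= !in_itv/=; split; [|split]; apply/andP; split; lra.
have mA o : measurable
    (A o : set ((measurableTypeR R * measurableTypeR R) * measurableTypeR R)).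
  by case: o => [m|]; rewrite /A ?cubeE; exact: measurable_box.
have muA o : mu3 (A o) = (v o)%:E.
  by case: o => [m|]; rewrite /A ?cubeE box_measure// ltW.
rewrite (integral_step c (mA None) mA AC muA) in le1.
have NE : #|site L|%:R = L%:R ^+ 3 :> R by rewrite card_site natrX.
rewrite /Ftilde.
apply: le_trans (lee_wpmul2l _ le1) _.
  by rewrite lee_fin divr_ge0// exprn_ge0// ltW.
rewrite -EFinM lee_fin big_cons big_map big_enum/=.
have sumE (E : R) : \sum_m (f m + err + M) * E =
    (\sum_m f m + L%:R ^+ 3 * (err + M)) * E.
  under eq_bigr do rewrite -addrA mulrDl.
  rewrite big_split/= -mulr_suml sumr_const -NE [in RHS]mulrDl; congr (_ + _).
  by rewrite -[RHS]mulrA mulr_natl.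
rewrite sumE.
rewrite le_eqVlt; apply/orP; left; apply/eqP.
by apply: average_identity; rewrite ?gt_eqF.
Qed.

End RiemannSum.

(** * Choice of the parameters and passage to the lower limit *)

Lemma limn_einf_ge (R : realType) (u : nat -> \bar R) (x : \bar R) (n0 : nat) :
  (forall n, (n0 <= n)%N -> (x <= u n)%E) -> (x <= limn_einf u)%E.
Proof.
move=> xu; rewrite -[limn_einf u]/(limf_einf u \oo) limf_einfE.
apply: (@le_trans _ _ (ereal_inf [set u n | n in [set n | (n0 <= n)%N]])).
  by apply: le_ereal_inf_tmp => _ [n /= n0n <-]; exact: xu.
by apply: ereal_sup_ubound; exists [set n | (n0 <= n)%N] => //; exists n0.
Qed.

Theorem theorem4p5 (R : realType) :
  forall eps : R, 0 < eps ->
  exists delta : R, 0 < delta /\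
  forall (J beta D : R), 0 < J -> 0 < beta -> 0 < D -> D < 1 ->
    beta * J * D ^+ 3 <= delta ->
    forall (ts : R) (a : 'I_3), 0 <= ts -> ts < 2 * pi ->
      (Ftilde ts a - eps%:E <=
       limn_einf (fun n : nat => (Ftilde_L (2 * n.+1) J beta D ts a)%:E))%E.
Proof.
(* The Taylor error per site is [9 * (beta * J * D ^+ 3)], with [9 = 18 / 2], hence at most
   [eps / 3]. *)
move=> eps eps0; exists (eps / 27); split; first exact: divr_gt0.
move=> J beta D J0 b0 D0 D1 bJD ts a _ _.
have bJ0 : 0 < beta * J by rewrite mulr_gt0.
(* At most 1 for the Lipschitz bounds, and so small that the regulator costs at most [eps / 6] per
   site. *)
pose lam := Num.min 1 (eps / (3 * (beta * J))).
have lam0 : 0 < lam by rewrite lt_min ltr01 divr_gt0// mulr_gt0.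
have lam1 : lam <= 1 by rewrite ge_min lexx.
have lamD : beta * J * (lam * D ^+ 2) <= eps / 3.
  have h1 : lam * D ^+ 2 <= lam.
    by apply: ler_piMr; [exact: ltW|apply: exprn_ile1; exact: ltW].
  have h2 : lam <= eps / (3 * (beta * J)) by rewrite ge_min lexx orbT.
  have -> : eps / 3 = beta * J * (eps / (3 * (beta * J))).
    by field; rewrite !gt_eqF.
  by apply: ler_wpM2l; [exact: ltW|exact: le_trans h2].
have p0 := twopi_gt0 R.
(* From [L >= y] on, the Riemann-sum error is at most [eps / 3]. *)
pose y := 41 * (2 * pi) / lam ^+ 2 / (eps / 3).
have y0 : 0 <= y.
  apply: divr_ge0; last by apply: divr_ge0 => //; exact: ltW.
  by apply: divr_ge0; [apply: mulr_ge0 => //; exact: ltW|rewrite exprn_ge0// ltW].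
apply: (@limn_einf_ge _ _ _ (Num.trunc y)) => n yn.
have /andP[_ yn1] := trunc_itv y0.
have yL : y <= (2 * n.+1)%:R.
  apply: le_trans (ltW yn1) _; rewrite ler_nat.
  by apply: (@leq_trans n.+1) => //; rewrite leq_pmull.
have L0 : 0 < (2 * n.+1)%:R :> R by rewrite ltr0n.
have riem : 41 * (2 * pi / (2 * n.+1)%:R) / lam ^+ 2 <= eps / 3.
  rewrite (_ : _ / lam ^+ 2 = 41 * (2 * pi) / lam ^+ 2 / (2 * n.+1)%:R); last first.
    by rewrite !mulrA mulrAC.
  by rewrite ler_pdivrMr// [leRHS]mulrC -ler_pdivrMr ?divr_gt0.
have := Ftilde_L_ge ts a (ltn0Sn n) J0 b0 D0 D1 lam0.
rewrite leeBlDr//; set S := _ * (\sum_k _) => FL.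
apply: (le_trans (Ftilde_le (ltn0Sn n) ts a lam0 lam1)).
rewrite -/S -EFinD lee_fin.
have E : beta * J / 2 * (lam * D ^+ 2 + 18 * D ^+ 3) =
   beta * J * (lam * D ^+ 2) / 2 + 9 * (beta * J * D ^+ 3) by field.
rewrite E in FL; move: FL riem lamD bJD.
move: (beta * J * (lam * D ^+ 2)) (beta * J * D ^+ 3) (Ftilde_L _ _ _ _ _ _) => u v w.
move: S (_ / lam ^+ 2) => s t *; lra.
Qed.
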